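(* Let $G$ be a finite, $3$-regular, vertex-transitive graph whose adjacency matrix has least eigenvalue $\lambda_{\min}$, and put $$q_3(\lambda_{\min})=\frac18+\frac{3}{4\pi}\arcsin\Bigl(\frac{1-\lambda_{\min}}{4}\Bigr)=\frac12-\frac{3}{4\pi}\arccos\Bigl(\frac{1-\lambda_{\min}}{4}\Bigr).$$ Then the independence ratio of $G$ is at least $q_3(\lambda_{\min})$. In fact, the following stronger statement holds: $G$ contains two disjoint independent sets $I_1,I_2$ with $|I_1\cup I_2|\ge 2q_3(\lambda_{\min})\,|V(G)|$; that is, the induced subgraph $G[I_1\cup I_2]$ is bipartite and has at least $2q_3(\lambda_{\min})|V(G)|$ vertices.
   Context: Graphs are simple and undirected. An independent set is a set of vertices no two of which are adjacent. The independence ratio of a finite graph is the size of its largest independent set divided by its number of vertices. A graph is vertex-transitive if its automorphism group acts transitively on its vertex set $V(G)$. *)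

(* Defs.v *)
From HB Require Import structures.
From mathcomp Require Import all_boot all_order all_algebra all_fingroup.
From mathcomp Require Import all_classical all_reals all_analysis.

Set Implicit Arguments.
Unset Strict Implicit.
Unset Printing Implicit Defensive.

Import Order.TTheory GRing.Theory Num.Theory.

Local Open Scope ring_scope.

Record sgraph := SGraph {
  vertex :> finType;
  adj : rel vertex;
  adj_sym : symmetric adj;
  adj_irr : irreflexive adj
}.

Definition regular (d : nat) (G : sgraph) : Prop :=
  forall x : G, #|[set y : G | adj x y]| = d.

Definition automorphism (G : sgraph) (s : {perm G}) : Prop :=
  forall x y : G, adj (s x) (s y) = adj x y.

Definition vertex_transitive (G : sgraph) : Prop :=
  forall x y : G, exists2 s : {perm G}, automorphism s & s x = y.

Definition independent (G : sgraph) (I : {set G}) : bool :=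
  [forall x in I, forall y in I, ~~ adj x y].

Definition independence_number (G : sgraph) : nat :=
  (\max_(I : {set G} | independent I) #|I|)%N.

Definition independence_ratio (R : realType) (G : sgraph) : R :=
  (independence_number G)%:R / #|G|%:R.

Lemma induced_sym (G : sgraph) (S : {set G}) :
  symmetric (fun u v : {x : G | x \in S} => adj (val u) (val v)).
Proof. by move=> u v; rewrite adj_sym. Qed.

Lemma induced_irr (G : sgraph) (S : {set G}) :
  irreflexive (fun u v : {x : G | x \in S} => adj (val u) (val v)).
Proof. by move=> u; rewrite adj_irr. Qed.

Definition induced_subgraph (G : sgraph) (S : {set G}) : sgraph :=
  SGraph (@induced_sym G S) (@induced_irr G S).

Definition bipartite (G : sgraph) : Prop :=
  exists c : G -> bool, forall x y : G, adj x y -> c x != c y.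

Definition adjacency_matrix (R : realType) (G : sgraph) : 'M[R]_#|G| :=
  \matrix_(i, j) (adj (enum_val i) (enum_val j))%:R.

(* Over R, [eigenvalue] only sees real eigenvalues; for the symmetric matrices
   considered here these are all of them. *)
Definition least_eigenvalue (R : realType) (n : nat) (A : 'M[R]_n) (a : R) :
    Prop :=
  eigenvalue A a /\ forall b : R, eigenvalue A b -> a <= b.

Definition q3 (R : realType) (a : R) : R :=
  8^-1 + 3 / (4 * pi) * asin ((1 - a) / 4).

(* Main.v *)
Require Import Defs.
From HB Require Import structures.
From mathcomp Require Import all_boot all_order all_algebra all_fingroup.
From mathcomp Require Import all_classical all_reals all_analysis.
From mathcomp Require Import measurable_realfun normal_distribution.
From mathcomp Require Import ring lra.

Set Implicit Arguments.
Unset Strict Implicit.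
Unset Printing Implicit Defensive.

Import Order.TTheory GRing.Theory Num.Theory.
Import numFieldNormedType.Exports.

Local Open Scope ring_scope.

(* Let [w] be an eigenfunction for the least eigenvalue [lam] and let [X] be the
   random eigenfunction [\sum_s g_s * (w \o s)], with [s] ranging over the
   automorphisms and [g_s] independent standard Gaussians.  Its law is invariant
   under automorphisms, so all vertices have the same variance.  The strict local
   maxima and the strict local minima of [X] form two disjoint independent sets.
   A vertex [v] with neighbours [u_i] is in one of them iff the three variables
   [X v - X u_i] have the same strict sign; counting the pairs of opposite sign,
   this has probability [1 - (\sum_(i < j) acos rho_ij) / (2 * pi)], where
   [rho_ij] are the correlations of these variables.

   The eigenvalue equation says that the matrix [rho] has eigenvalue
   [(3 - lam) / 2] with a positive eigenvector (the vector of standard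
   deviations).  With [nu = (1 - lam) / 2], this means that [rho_ij = nu * cos A],
   [A] ranging over the angles of a triangle.  As [lam <= -1], we have [1 <= nu],
   and then [\sum_A acos (nu * cos A)] is largest for the equilateral triangle. *)

(** * Rotation invariance of Lebesgue measure on the plane *)

Section LebesguePlane.
Variable R : realType.
Local Notation mu := (@lebesgue_measure R).
Local Notation mR := (measurableTypeR R).
Implicit Types (f : mR -> \bar R) (H : (mR * mR)%type -> \bar R).
Local Open Scope classical_set_scope.

(** By uniqueness of Lebesgue measure, half-open intervals suffice. *)
Lemma lebesgue_measure_shift (a : R) (A : set mR) : measurable A ->
  pushforward mu (fun x : mR => x + a : mR) A = mu A.
Proof.
have mD : measurable_fun [set: mR] (fun x : mR => x + a : mR).
  exact: measurable_funD.
move=> mA; apply/esym; apply: (@lebesgue_measure_unique R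
  (pushforward mu (fun x : mR => x + a : mR))) => //= _ [[b c]] _ <-.
rewrite /pushforward /=.
have -> : (fun x : R => x + a) @^-1` `]b, c] = `]b - a, c - a]%classic.
  by apply/seteqP; split => x /=; rewrite !in_itv /=; lra.
rewrite !lebesgue_measure_itv /= !lte_fin ltrD2r; case: ifPn => // _.
by rewrite -!EFinB; congr (_%:E); ring.
Qed.

Lemma ge0_integral_shift f (a : R) : measurable_fun setT f ->
  (forall x, 0 <= f x)%E -> (\int[mu]_x f (x + a)%R = \int[mu]_x f x)%E.
Proof.
move=> mf f0.
have mD : measurable_fun [set: mR] (fun x : mR => x + a : mR).
  exact: measurable_funD.
have := @ge0_integral_pushforward _ _ mR mR R _ mD mu setT f measurableT mf
  (fun y _ => f0 y).
rewrite preimage_setT => <-.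
by apply: eq_measure_integral => //= A mA _; exact: lebesgue_measure_shift.
Qed.

(** An iterated integral, so that a shear acts as a translation in one of the two variables. *)
Definition plane_integral H := (\int[mu]_x \int[mu]_y H (x, y))%E.

Definition plane_map (a b c d : R) (w : (mR * mR)%type) : (mR * mR)%type :=
  (a * w.1 + b * w.2, c * w.1 + d * w.2).

Lemma measurable_plane_map a b c d : measurable_fun setT (plane_map a b c d).
Proof.
have ml (p q : R) :
    measurable_fun setT (fun w : (mR * mR)%type => p * w.1 + q * w.2).
  by apply: measurable_funD; apply: measurable_funM.
exact: (measurable_fun_pair (ml a b) (ml c d)).
Qed.

Lemma plane_integral_shear_fst H (t : R) : measurable_fun setT H ->
  (forall w, 0 <= H w)%E ->
  plane_integral (H \o plane_map 1 t 0 1) = plane_integral H.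
Proof.
move=> mH H0; rewrite /plane_integral.
have m1 := measurableT_comp mH (measurable_plane_map 1 t 0 1).
rewrite (fubini_tonelli _ m1 (fun w => H0 _)).
rewrite (fubini_tonelli _ mH H0); apply: eq_integral => y _.
rewrite /plane_map /=.
under eq_integral do rewrite mul1r mul0r add0r mul1r.
apply: (@ge0_integral_shift (fun x => H (x, y)) (t * y)) => //.
exact: measurable_fun_pair1.

Qed.

Lemma plane_integral_shear_snd H (t : R) : measurable_fun setT H ->
  (forall w, 0 <= H w)%E ->
  plane_integral (H \o plane_map 1 0 t 1) = plane_integral H.
Proof.
move=> mH H0; rewrite /plane_integral; apply: eq_integral => x _.
rewrite /plane_map /=.
under eq_integral do rewrite mul1r mul0r addr0 mul1r addrC.
apply: (@ge0_integral_shift (fun y => H (x, y)) (t * x)) => //.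
exact: measurable_fun_pair2.
Qed.

(* A rotation is a product of three shears, which preserve Lebesgue measure by
   Fubini and translation invariance. *)
Lemma plane_integral_rot_shears H (c s : R) : s != 0 -> c ^+ 2 + s ^+ 2 = 1 ->
  measurable_fun setT H -> (forall w, 0 <= H w)%E ->
  plane_integral (H \o plane_map c (- s) s c) = plane_integral H.
Proof.
(* For the angle [theta] of the rotation, [t] is minus the tangent of [theta / 2]. *)
move=> s0 cs mH H0; pose t := (c - 1) / s.
have ts : t * s = c - 1 by rewrite /t divfK.
have tc : t * (c + 1) = - s.
  apply: (mulIf s0); rewrite mulrAC ts; lra.
have -> : H \o plane_map c (- s) s c =
    ((H \o plane_map 1 t 0 1) \o plane_map 1 0 s 1) \o plane_map 1 t 0 1.
  apply/funext => -[x y]; rewrite /plane_map /=; congr (H (_, _)).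
  - transitivity ((1 + t * s) * x + (t * (1 + t * s) + t) * y); last by ring.
    rewrite ts -tc; ring.
  - transitivity (s * x + (t * s + 1) * y); last by ring.
    rewrite ts; ring.
have m1 := measurableT_comp mH (measurable_plane_map 1 t 0 1).
have m2 := measurableT_comp m1 (measurable_plane_map 1 0 s 1).
rewrite (plane_integral_shear_fst t m2 (fun w => H0 _)).
rewrite (plane_integral_shear_snd s m1 (fun w => H0 _)).
exact: plane_integral_shear_fst.
Qed.

(** The case [s = 0], where the shears are undefined, is the identity or the half-turn, and the
    latter is the square of a quarter-turn. *)
Lemma plane_integral_rot H (c s : R) : c ^+ 2 + s ^+ 2 = 1 ->
  measurable_fun setT H -> (forall w, 0 <= H w)%E ->
  plane_integral (H \o plane_map c (- s) s c) = plane_integral H.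
Proof.
move=> cs mH H0; have [s0|] := eqVneq s 0; last first.
  by move=> s0; exact: plane_integral_rot_shears.
move: cs; rewrite s0 expr0n addr0 => /eqP; rewrite sqrf_eq1 => /orP[]/eqP ->.
  congr plane_integral; apply/funext => -[x y].
  by rewrite /plane_map /= oppr0 !mul1r !mul0r addr0 add0r.
have -> : H \o plane_map (-1) (- 0) 0 (-1) =
    (H \o plane_map 0 (- 1) 1 0) \o plane_map 0 (- 1) 1 0.
  by apply/funext => -[x y]; rewrite /plane_map /=; congr (H (_, _)); ring.
have e : (0 : R) ^+ 2 + 1 ^+ 2 = 1 by rewrite expr0n add0r expr1n.
have m1 := measurableT_comp mH (measurable_plane_map 0 (-1) 1 0).
rewrite (plane_integral_rot_shears (oner_neq0 R) e m1 (fun w => H0 _)).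
exact: (plane_integral_rot_shears (oner_neq0 R) e).
Qed.

End LebesguePlane.

(** * Gaussian averages along a direction *)

Section GaussianAverage.
Variable R : realType.
Local Notation mu := (@lebesgue_measure R).
Local Notation mR := (measurableTypeR R).
Local Notation plane := (mR * mR)%type.
Implicit Types (F G : plane -> \bar R) (u v z : plane).
Local Open Scope classical_set_scope.

Definition gauss_density : mR -> R := normal_pdf 0 1.

Lemma gauss_density_ge0 x : 0 <= gauss_density x.
Proof. exact: normal_pdf_ge0. Qed.

Lemma measurable_gauss_density : measurable_fun setT gauss_density.
Proof. exact: measurable_normal_pdf. Qed.

Lemma integral_gauss_density : (\int[mu]_x (gauss_density x)%:E = 1)%E.
Proof. exact: integral_normal_pdf. Qed.

(** The product depends only on [x ^+ 2 + y ^+ 2], which a rotation preserves. *)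
Lemma gauss_density_prod_rot (c s x y : R) : c ^+ 2 + s ^+ 2 = 1 ->
  gauss_density (c * x - s * y) * gauss_density (s * x + c * y) =
  gauss_density x * gauss_density y.
Proof.
move=> cs; rewrite /gauss_density normal_pdfE ?oner_neq0// /normal_fun.
rewrite mulrACA -expRD [RHS]mulrACA -expRD !subr0; congr (_ * expR _).
rewrite -!mulrDl -!opprD; congr (- _ / _).
transitivity ((c ^+ 2 + s ^+ 2) * (x ^+ 2 + y ^+ 2)); first by ring.
by rewrite cs mul1r.
Qed.

(** The expectation of [F (z + g u)] for a standard Gaussian [g]. Iterating it gives expectations
    over several independent Gaussians. *)
Definition gavg u F z : \bar R :=
  (\int[mu]_x (F (z.1 + x * u.1, z.2 + x * u.2)%R * (gauss_density x)%:E))%E.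

Lemma measurable_move u :
  measurable_fun setT
    (fun p : (plane * mR)%type => (p.1.1 + p.2 * u.1, p.1.2 + p.2 * u.2)).
Proof.
apply: measurable_fun_pair.
- apply: measurable_funD; last exact: measurable_funM.
  exact: (measurableT_comp measurable_fst measurable_fst).
- apply: measurable_funD; last exact: measurable_funM.
  exact: (measurableT_comp measurable_snd measurable_fst).
Qed.

Lemma measurable_gavg_kernel u F : measurable_fun setT F ->
  measurable_fun setT (fun p : (plane * mR)%type =>
    (F (p.1.1 + p.2 * u.1, p.1.2 + p.2 * u.2)%R * (gauss_density p.2)%:E)%E).
Proof.
move=> mF; apply: emeasurable_funM.
  exact: (measurableT_comp mF (measurable_move u)).
apply/measurable_EFinP.
exact: (measurableT_comp measurable_gauss_density measurable_snd).
Qed.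

Lemma measurable_gavg_integrand u F z : measurable_fun setT F ->
  measurable_fun setT (fun x : mR =>
    (F (z.1 + x * u.1, z.2 + x * u.2)%R * (gauss_density x)%:E)%E).
Proof.
by move=> mF; apply: (measurable_fun_pair2 z (measurable_gavg_kernel u mF)).
Qed.

Lemma gavg_integrand_ge0 u F z x : (forall z, 0 <= F z)%E ->
  (0 <= F (z.1 + x * u.1, z.2 + x * u.2)%R * (gauss_density x)%:E)%E.
Proof. by move=> F0; rewrite mule_ge0// lee_fin gauss_density_ge0. Qed.

Lemma measurable_gavg u F : measurable_fun setT F -> (forall z, 0 <= F z)%E ->
  measurable_fun setT (gavg u F).
Proof.
move=> mF F0; apply: (measurable_fun_fubini_tonelli_F
  (fun p : (plane * mR)%type =>
    (F (p.1.1 + p.2 * u.1, p.1.2 + p.2 * u.2)%R * (gauss_density p.2)%:E)%E)).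
  exact: measurable_gavg_kernel.
by move=> p; exact: (@gavg_integrand_ge0 u F p.1 p.2).
Qed.

Lemma gavg_ge0 u F z : (forall z, 0 <= F z)%E -> (0 <= gavg u F z)%E.
Proof. by move=> F0; apply: integral_ge0 => x _; exact: gavg_integrand_ge0. Qed.

Lemma gavg_le u F G z : measurable_fun setT F -> (forall z, 0 <= F z)%E ->
  measurable_fun setT G -> (forall z, F z <= G z)%E ->
  (gavg u F z <= gavg u G z)%E.
Proof.
move=> mF F0 mG FG; apply: ge0_le_integral => //.
- by move=> x _; exact: gavg_integrand_ge0.
- exact: measurable_gavg_integrand.
- exact: measurable_gavg_integrand.
- by move=> x _; rewrite lee_wpmul2r// lee_fin gauss_density_ge0.
Qed.

Lemma gavgD u F G z : measurable_fun setT F -> (forall z, 0 <= F z)%E ->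
  measurable_fun setT G -> (forall z, 0 <= G z)%E ->
  (gavg u (fun w => F w + G w) z = gavg u F z + gavg u G z)%E.
Proof.
move=> mF F0 mG G0; rewrite /gavg -ge0_integralD//.
- by apply: eq_integral => x _; rewrite ge0_muleDl.
- by move=> x _; exact: gavg_integrand_ge0.
- exact: measurable_gavg_integrand.
- by move=> x _; exact: gavg_integrand_ge0.
- exact: measurable_gavg_integrand.
Qed.

Lemma gavg_cst u (k : R) z : 0 <= k -> (gavg u (cst k%:E) z = k%:E)%E.
Proof.
move=> k0; rewrite /gavg ge0_integralZl//.
- by rewrite integral_gauss_density mule1.
- apply/measurable_EFinP; exact: measurable_gauss_density.
- by move=> x _; rewrite lee_fin gauss_density_ge0.
Qed.

Lemma gavg_zero F z : (forall z, 0 <= F z)%E -> gavg (0, 0) F z = F z.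
Proof.
move=> F0; rewrite /gavg /=.
under eq_integral do rewrite mulr0 !addr0.
rewrite -surjective_pairing ge0_integralZl//.
- by rewrite integral_gauss_density mule1.
- apply/measurable_EFinP; exact: measurable_gauss_density.
- by move=> x _; rewrite lee_fin gauss_density_ge0.
Qed.

Definition gavg2_integrand u v F z (w : plane) : \bar R :=
  (F (z.1 + w.1 * u.1 + w.2 * v.1, z.2 + w.1 * u.2 + w.2 * v.2)%R *
    (gauss_density w.1 * gauss_density w.2)%:E)%E.

Lemma measurable_gavg2_integrand u v F z : measurable_fun setT F ->
  measurable_fun setT (gavg2_integrand u v F z).
Proof.
move=> mF; apply: emeasurable_funM.
  have ml (p q r : R) :
      measurable_fun setT (fun w : plane => p + w.1 * q + w.2 * r).
    apply: measurable_funD; last exact: measurable_funM.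
    by apply: measurable_funD => //; exact: measurable_funM.
  exact: (measurableT_comp mF (measurable_fun_pair (ml _ _ _) (ml _ _ _))).
apply/measurable_EFinP; apply: measurable_funM.
  exact: (measurableT_comp measurable_gauss_density measurable_fst).
exact: (measurableT_comp measurable_gauss_density measurable_snd).
Qed.

Lemma gavg2_integrand_ge0 u v F z w : (forall z, 0 <= F z)%E ->
  (0 <= gavg2_integrand u v F z w)%E.
Proof.
by move=> F0; rewrite mule_ge0// lee_fin mulr_ge0// gauss_density_ge0.
Qed.

Lemma gavg_gavg u v F z : measurable_fun setT F -> (forall z, 0 <= F z)%E ->
  gavg u (gavg v F) z = plane_integral (gavg2_integrand u v F z).
Proof.
move=> mF F0; apply: eq_integral => x _.
rewrite /gavg -ge0_integralZr//.
- apply: eq_integral => y _; rewrite /gavg2_integrand -muleA -EFinM.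
  by rewrite [(gauss_density y * _)%R]mulrC.
- exact: measurable_gavg_integrand.
- by move=> y _; exact: gavg_integrand_ge0.
- by rewrite lee_fin gauss_density_ge0.
Qed.

(** Two independent Gaussian coefficients may be rotated without changing their joint law; the
    rotation is transferred to the directions [u] and [v]. *)
Lemma gavg_rot (c s : R) u v F z : c ^+ 2 + s ^+ 2 = 1 ->
  measurable_fun setT F -> (forall z, 0 <= F z)%E ->
  gavg u (gavg v F) z =
  gavg (c * u.1 + s * v.1, c * u.2 + s * v.2)
    (gavg (- s * u.1 + c * v.1, - s * u.2 + c * v.2) F) z.
Proof.
move=> cs mF F0; rewrite (gavg_gavg u v z mF F0) (gavg_gavg _ _ z mF F0).
rewrite -(plane_integral_rot cs (measurable_gavg2_integrand u v z mF)
  (fun w => gavg2_integrand_ge0 u v z w F0)).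
congr plane_integral; apply/funext => -[x y].
rewrite /gavg2_integrand /plane_map /= mulNr gauss_density_prod_rot//.
by congr (F (_, _) * _)%E; ring.
Qed.

End GaussianAverage.

(** * Signs of a pair of Gaussian variables *)

(** A Givens rotation, used below to clear one coordinate of a direction. *)
Lemma rot_exists (R : realType) (a b : R) : exists c s : R,
  [/\ c ^+ 2 + s ^+ 2 = 1, c * a + s * b = Num.sqrt (a ^+ 2 + b ^+ 2)
    & - s * a + c * b = 0].
Proof.
set r := Num.sqrt _.
have r2 : r ^+ 2 = a ^+ 2 + b ^+ 2 by rewrite sqr_sqrtr// addr_ge0// sqr_ge0.
have [r0|r0] := eqVneq r 0.
  move: r2; rewrite r0 expr0n => /esym/eqP.
  rewrite paddr_eq0 ?sqr_ge0// !sqrf_eq0 => /andP[/eqP-> /eqP->].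
  by exists 1, 0; split; rewrite ?mulr0 ?addr0// expr1n expr0n addr0.
exists (a / r), (b / r); split.
- by rewrite !expr_div_n -mulrDl -r2 divff// sqrf_eq0.
- by rewrite mulrAC [b / r * b]mulrAC -mulrDl -!expr2 -r2 expr2 mulfK.
- by ring.
Qed.

Section SignCorrelation.
Variable R : realType.
Local Notation mR := (measurableTypeR R).
Local Notation plane := (mR * mR)%type.
Implicit Types (F G : plane -> \bar R) (u v z w : plane).
Local Open Scope classical_set_scope.

Definition gavgs (us : seq plane) F : plane -> \bar R := foldr (@gavg R) F us.

Lemma measurable_gavgs us F : measurable_fun setT F ->
  (forall z, 0 <= F z)%E ->
  measurable_fun setT (gavgs us F) /\ (forall z, 0 <= gavgs us F z)%E.
Proof.
move=> mF F0; elim: us => //= u us [IHm IH0].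
by split=> [|z]; [exact: measurable_gavg|exact: gavg_ge0].
Qed.

(** A centred Gaussian vector in the plane is determined in law by its covariance matrix, whose
    Cholesky factor has the rows [(a, b)] and [(0, d)]. It is built up one direction at a time by
    Givens rotations. *)
Lemma gavgs_reduce us F : measurable_fun setT F -> (forall z, 0 <= F z)%E ->
  exists a b d : R, [/\ 0 <= a, 0 <= d,
    [/\ a ^+ 2 = \sum_(u <- us) u.1 ^+ 2, a * b = \sum_(u <- us) u.1 * u.2
      & b ^+ 2 + d ^+ 2 = \sum_(u <- us) u.2 ^+ 2]
    & forall z, gavgs us F z = gavg (a, b) (gavg (0, d) F) z].
Proof.
move=> mF F0; elim: us => [|u us [a [b [d [a0 d0 [e1 e2 e3] E]]]]].
  exists 0, 0, 0; rewrite !big_nil; split=> //.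
    by split; rewrite ?mulr0 ?expr0n ?addr0.
  by move=> z /=; rewrite !gavg_zero// => w; exact: gavg_ge0.
rewrite !big_cons /=.
(* The pair [u], [(a, b)] is rotated to [(a', b')], [(0, y)]; then the pair [(0, y)], [(0, d)] is
   rotated to [(0, d')], [(0, 0)], and the zero direction drops out. *)
have [c [s [cs ca ss]]] := rot_exists u.1 a.
set a' := Num.sqrt _ in ca.
set b' := c * u.2 + s * b; set y := - s * u.2 + c * b.
have [c' [s' [cs' ca' ss']]] := rot_exists y d.
set d' := Num.sqrt _ in ca'.
have d'2 : d' ^+ 2 = y ^+ 2 + d ^+ 2 by rewrite sqr_sqrtr// addr_ge0// sqr_ge0.
have a'2 : a' ^+ 2 = u.1 ^+ 2 + a ^+ 2.
  by rewrite sqr_sqrtr// addr_ge0// sqr_ge0.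
have mG := measurable_gavg (0, d) mF F0.
have G0 w : (0 <= gavg (0%R, d) F w)%E by exact: gavg_ge0.
exists a', b', d'; split.
- exact: sqrtr_ge0.
- exact: sqrtr_ge0.
- split; first by rewrite a'2 e1.
  + rewrite -e2 -[a' * b']addr0 -(mul0r y) -ss -ca /b' /y.
    transitivity ((c ^+ 2 + s ^+ 2) * (u.1 * u.2 + a * b)); first by ring.
    by rewrite cs mul1r.
  + rewrite -e3 d'2 /b' /y.
    transitivity ((c ^+ 2 + s ^+ 2) * (u.2 ^+ 2 + b ^+ 2) + d ^+ 2).
      by ring.
    by rewrite cs mul1r addrA.
- move=> z.
  have -> : gavgs us F = gavg (a, b) (gavg (0, d) F) by apply/funext.
  rewrite (gavg_rot _ _ _ cs mG G0) /= ca ss -/b' -/y.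
  congr (gavg _ _ z); apply/funext => w.
  rewrite (gavg_rot _ _ _ cs' mF F0) /= !mulr0 !addr0 ca' ss'.
  by congr (gavg _ _ w); apply/funext => w'; rewrite gavg_zero.
Qed.

Definition gauss_plane F : \bar R := gavg (1, 0) (gavg (0, 1) F) (0, 0).

Lemma measurable_lin_pair (a b c d : R) :
  measurable_fun setT
    (fun w : plane => (w.1 * a + w.2 * b, w.1 * c + w.2 * d) : plane).
Proof.
have ml (p q : R) : measurable_fun setT (fun w : plane => w.1 * p + w.2 * q).
  by apply: measurable_funD; apply: measurable_funM.
exact: (measurable_fun_pair (ml a b) (ml c d)).
Qed.

Lemma gavg2_gauss_plane u v F : measurable_fun setT F ->
  (forall z, 0 <= F z)%E ->
  gavg u (gavg v F) (0, 0) =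
  gauss_plane (fun w => F (w.1 * u.1 + w.2 * v.1, w.1 * u.2 + w.2 * v.2)).
Proof.
move=> mF F0; rewrite /gauss_plane gavg_gavg//.
have mF' := measurableT_comp mF (measurable_lin_pair u.1 v.1 u.2 v.2).
rewrite (gavg_gavg _ _ _ mF' (fun w => F0 _)).
congr plane_integral; apply/funext => w; rewrite /gavg2_integrand /=.
by congr (F (_, _) * _)%E; ring.
Qed.

Lemma gauss_plane_le F G : measurable_fun setT F -> (forall z, 0 <= F z)%E ->
  measurable_fun setT G -> (forall z, F z <= G z)%E ->
  (gauss_plane F <= gauss_plane G)%E.
Proof.
move=> mF F0 mG FG.
have G0 z : (0 <= G z)%E by exact: le_trans (FG z).
apply: gavg_le => //.
- exact: measurable_gavg.
- by move=> z; exact: gavg_ge0.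
- exact: measurable_gavg.
- by move=> z; exact: gavg_le.
Qed.

Lemma gauss_planeD F G : measurable_fun setT F -> (forall z, 0 <= F z)%E ->
  measurable_fun setT G -> (forall z, 0 <= G z)%E ->
  (gauss_plane (fun w => F w + G w) = gauss_plane F + gauss_plane G)%E.
Proof.
move=> mF F0 mG G0; rewrite /gauss_plane.
have -> : gavg (0, 1) (fun w => F w + G w)%E =
    (fun z => gavg (0%R, 1%R) F z + gavg (0%R, 1%R) G z)%E.
  by apply/funext => z; exact: gavgD.
by apply: gavgD; [exact: measurable_gavg|move=> z; exact: gavg_ge0|
  exact: measurable_gavg|move=> z; exact: gavg_ge0].
Qed.

Lemma gauss_plane1 : gauss_plane (cst 1%E) = 1%E.
Proof.
rewrite /gauss_plane.
have -> : gavg (0, 1) (cst 1%E) = cst 1%E :> (plane -> \bar R).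
  by apply/funext => z; exact: gavg_cst.
exact: gavg_cst.
Qed.

Lemma gauss_plane_ge0 F : (forall z, 0 <= F z)%E -> (0 <= gauss_plane F)%E.
Proof. by move=> F0; apply: gavg_ge0 => z; exact: gavg_ge0. Qed.

Definition dir (t : R) (w : plane) : R := w.1 * cos t + w.2 * sin t.

Lemma measurable_dir t : measurable_fun setT (dir t : plane -> mR).
Proof. by apply: measurable_funD; apply: measurable_funM. Qed.

(** Ties count as disagreement, so agreement means a common strict sign. This is what makes the
    local extrema strict. *)
Definition disagree (w : plane) : \bar R := if w.1 * w.2 <= 0 then 1%E else 0%E.

Lemma disagree_ge0 w : (0 <= disagree w)%E.
Proof. by rewrite /disagree; case: ifP. Qed.

Lemma disagree_le1 w : (disagree w <= 1)%E.
Proof. by rewrite /disagree; case: ifP. Qed.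

Lemma measurable_disagree : measurable_fun setT disagree.
Proof.
apply: measurable_fun_ifT => //; apply: measurable_fun_ler => //.
exact: measurable_funM.
Qed.

(* The value 2 dominates the sum of two values of [disagree]. *)
Definition vanish (w : plane) : \bar R := if w.1 == 0 then 2%:E else 0%E.

Lemma vanish_ge0 w : (0 <= vanish w)%E.
Proof. by rewrite /vanish; case: ifP. Qed.

Lemma measurable_vanish : measurable_fun setT vanish.
Proof. by apply: measurable_fun_ifT => //; apply: measurable_fun_eqr. Qed.

(** A line through the origin is a null set: a rotation makes it vertical, and the inner variable
    then integrates out, leaving an integral over a single point. *)
Lemma gauss_plane_vanish t :
  gauss_plane (fun w => vanish (dir t w, dir (t + pi / 2) w)) = 0%E.
Proof.
have := cos2Dsin2 (- t); rewrite cosN sinN => cs.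
transitivity (gavg (1, 0) (gavg (0, 1) vanish) (0, 0)).
  rewrite (gavg_rot _ _ _ cs measurable_vanish vanish_ge0) /=.
  rewrite (gavg2_gauss_plane _ _ measurable_vanish vanish_ge0) /=.
  congr gauss_plane; apply/funext => w; rewrite /dir; congr vanish.
  rewrite cosDpihalf sinDpihalf.
  by congr (_, _); ring.
have -> : gavg (0, 1) vanish = vanish.
  apply/funext => z; rewrite -[RHS](gavg_zero _ vanish_ge0).
  by apply: eq_integral => y _; rewrite /vanish /= !mulr0.
rewrite /gavg -[RHS](integral_set1
  (fun x : R => vanish (x, 0%R) * (gauss_density x)%:E)%E 0) [RHS]integral_mkcond.
apply: eq_integral => x _; rewrite /patch /= !(add0r, mulr1, mulr0).
case: ifPn => // x0; rewrite /vanish /=; case: eqP => [xE|]; last first.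
  by rewrite mul0e.
by case/negP: x0; apply: mem_set.
Qed.

Lemma dir_between a b c w :
  sin (c - a) * dir b w = sin (c - b) * dir a w + sin (b - a) * dir c w.
Proof.
by rewrite /dir !sinB; ring. Qed.

(** If [sin (c - a)] is positive, [dir_between] writes [dir b w] as a nonnegative combination of
    [dir a w] and [dir c w]. Otherwise [c = a], or [c = a + pi] and the two outer values have
    opposite signs. *)
Lemma dir_same_sign a b c w : a <= b -> b <= c -> c - a <= pi ->
  0 < dir a w * dir c w -> dir b w != 0 ->
  0 < dir a w * dir b w /\ 0 < dir b w * dir c w.
Proof.
move=> ab bc ca; have := dir_between a b c w.
have [sca|] := ltP 0 (sin (c - a)).
  have : 0 <= sin (c - b) by apply: sin_ge0_pi; lra.
  have : 0 <= sin (b - a) by apply: sin_ge0_pi; lra.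
  set p := dir a w; set q := dir b w; set r := dir c w.
  move=> s1 s2 e pr q0.
  have pq : 0 <= sin (c - a) * (p * q).
    rewrite mulrCA e mulrDr mulrCA -expr2 addr_ge0//.
      by rewrite mulr_ge0// sqr_ge0.
    by rewrite mulrCA mulr_ge0// ltW.
  have qr : 0 <= sin (c - a) * (q * r).
    rewrite mulrA e mulrDl -!mulrA -expr2 addr_ge0//.
      by rewrite mulr_ge0// ltW.
    by rewrite mulr_ge0// sqr_ge0.
  rewrite (pmulr_rge0 _ sca) in pq; rewrite (pmulr_rge0 _ sca) in qr.
  have [p0 r0] : p != 0 /\ r != 0.
    by apply/andP; rewrite -negb_or -mulf_eq0 gt_eqF.
  by split; rewrite lt_neqAle eq_sym mulf_neq0.
have [ca0|ca0] := eqVneq c a.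
  by move: ab bc; rewrite ca0 => ab ba; have -> : b = a by lra.
have [caE|ca1] := eqVneq (c - a) pi.
  move=> _ _; have -> : dir c w = - dir a w.
    have -> : c = a + pi by lra.
    by rewrite /dir cosDpi sinDpi !mulrN -opprD.
  by rewrite mulrN oppr_gt0 ltNge -expr2 sqr_ge0.
rewrite leNgt sin_gt0_pi// subr_gt0 !lt_neqAle eq_sym ca0 ca1 /=.
by rewrite (le_trans ab bc).
Qed.

Definition angle_prob (a b : R) : \bar R :=
  gauss_plane (fun w => disagree (dir a w, dir b w)).

Lemma measurable_disagree_dir a b :
  measurable_fun setT (fun w => disagree (dir a w, dir b w)).
Proof.
exact: (measurableT_comp measurable_disagree
  (measurable_fun_pair (measurable_dir a) (measurable_dir b))).
Qed.

Lemma measurable_vanish_dir a :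
  measurable_fun setT (fun w => vanish (dir a w, dir (a + pi / 2) w)).
Proof.
exact: (measurableT_comp measurable_vanish
  (measurable_fun_pair (measurable_dir a) (measurable_dir (a + pi / 2)))).
Qed.

Lemma angle_prob_rot a b : angle_prob a b = angle_prob 0 (b - a).
Proof.
have cs := cos2Dsin2 a.
transitivity (gavg (cos a, cos b) (gavg (sin a, sin b) disagree) (0, 0)).
  by rewrite (gavg2_gauss_plane _ _ measurable_disagree disagree_ge0).
rewrite (gavg_rot _ _ _ cs measurable_disagree disagree_ge0) /=.
rewrite (gavg2_gauss_plane _ _ measurable_disagree disagree_ge0) /=.
congr gauss_plane; apply/funext => w; rewrite /dir cos0 sin0 cosB sinB.
rewrite -!expr2 cs; congr (disagree (_, _)); ring.
Qed.

Lemma angle_prob_ge0 a b : (0 <= angle_prob a b)%E.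
Proof. by apply: gauss_plane_ge0 => w; exact: disagree_ge0. Qed.

Lemma angle_prob_le1 a b : (angle_prob a b <= 1)%E.
Proof.
rewrite -gauss_plane1; apply: gauss_plane_le => //.
- exact: measurable_disagree_dir.
- by move=> z; exact: disagree_ge0.
- by move=> z; exact: disagree_le1.
Qed.

(** The inequality holds pointwise: if the signs along [a] and [b] agree strictly, and those along
    [b] and [c] too, then so do those along [a] and [c]. *)
Lemma angle_prob_sub a b c :
  (angle_prob a c <= angle_prob a b + angle_prob b c)%E.
Proof.
rewrite /angle_prob -gauss_planeD; first last.
- by move=> z; exact: disagree_ge0.
- exact: measurable_disagree_dir.
- by move=> z; exact: disagree_ge0.
- exact: measurable_disagree_dir.
apply: gauss_plane_le.
- exact: measurable_disagree_dir.
- by move=> z; exact: disagree_ge0.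
- by apply: emeasurable_funD; exact: measurable_disagree_dir.
move=> w; rewrite /disagree /=; set p := dir a w; set q := dir b w.
set r := dir c w; have [pr|_] := ifPn; last by rewrite adde_ge0//; case: ifP.
have [pq|/negP] := ifPn; first by rewrite leeDl//; case: ifP.
have [qr|/negP] := ifPn; first by rewrite add0e.
move=> /negP; rewrite -ltNge => qr /negP; rewrite -ltNge => pq.
exfalso; nra.
Qed.

(** Where no direction vanishes, [b] disagrees with at most one of [a] and [c], and with neither if
    these agree. On the three null lines that remain, [vanish] dominates the left side. *)
Lemma angle_prob_super a b c : a <= b -> b <= c -> c - a <= pi ->
  (angle_prob a b + angle_prob b c <= angle_prob a c)%E.
Proof.
move=> ab bc ca.
pose V t w := vanish (dir t w, dir (t + pi / 2) w).
have mV t : measurable_fun setT (V t) by exact: measurable_vanish_dir.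
have V0 t w : (0 <= V t w)%E by exact: vanish_ge0.
have mD s t := measurable_disagree_dir s t.
have D0 s t w : (0 <= disagree (dir s w, dir t w))%E by exact: disagree_ge0.
have VV0 w : (0 <= V a w + V b w)%E by rewrite adde_ge0.
have mVV : measurable_fun setT (fun w => V a w + V b w)%E.
  exact: emeasurable_funD.
have VVV0 w : (0 <= V a w + V b w + V c w)%E by rewrite adde_ge0.
have mVVV : measurable_fun setT (fun w => V a w + V b w + V c w)%E.
  exact: emeasurable_funD.
rewrite /angle_prob -(gauss_planeD (mD a b) (D0 a b) (mD b c) (D0 b c)).
apply: (@le_trans _ _ (gauss_plane (fun w => disagree (dir a w, dir c w) +
    (V a w + V b w + V c w))%E)); last first.
  rewrite (gauss_planeD (mD a c) (D0 a c) mVVV VVV0).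
  rewrite (gauss_planeD mVV VV0 (mV c) (V0 c)).
  rewrite (gauss_planeD (mV a) (V0 a) (mV b) (V0 b)).
  by rewrite !gauss_plane_vanish !adde0.
apply: gauss_plane_le.
- exact: emeasurable_funD.
- by move=> w; rewrite adde_ge0.
- exact: emeasurable_funD.
move=> w; have H := @dir_same_sign a b c w ab bc ca.
have le2 : (disagree (dir a w, dir b w) + disagree (dir b w, dir c w) <= 2%:E)%E.
  have -> : (2%:E = 1 + 1 :> \bar R)%E by rewrite -EFinD; congr EFin; ring.
  by apply: leeD; exact: disagree_le1.
have V2 t : dir t w = 0 -> V t w = 2%:E.
  by move=> t0; rewrite /V /vanish /= t0 eqxx.
have [/V2 Va|p0] := eqVneq (dir a w) 0.
  apply: (le_trans le2); apply: (le_trans _ (leeDr _ (D0 _ _ w))).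
  by rewrite Va -addeA leeDl// adde_ge0.
have [/V2 Vb|q0] := eqVneq (dir b w) 0.
  apply: (le_trans le2); apply: (le_trans _ (leeDr _ (D0 _ _ w))).
  by rewrite Vb (le_trans _ (leeDl _ (V0 c w)))// leeDr.
have [/V2 Vc|r0] := eqVneq (dir c w) 0.
  apply: (le_trans le2); apply: (le_trans _ (leeDr _ (D0 _ _ w))).
  by rewrite Vc leeDr.
apply: (le_trans _ (leeDl _ (VVV0 w))).
move: H p0 q0 r0; rewrite /disagree /=; set p := dir a w; set q := dir b w.
set r := dir c w => H p0 q0 r0; have [pr|pr] := leP (p * r) 0; last first.
  by have [pq qr] := H pr q0; rewrite (lt_geF pq) (lt_geF qr) adde0.
have [pq|_] := leP (p * q) 0; last by rewrite add0e; case: ifP.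
have [qr|_] := leP (q * r) 0; last by rewrite adde0.
have {}pq : p * q < 0 by rewrite lt_neqAle pq mulf_neq0.
have {}qr : q * r < 0 by rewrite lt_neqAle qr mulf_neq0.
have : 0 < (p * r) * q ^+ 2.
  by have -> : p * r * q ^+ 2 = (p * q) * (q * r) by [ring]; rewrite nmulr_rgt0.
by rewrite pmulr_lgt0 ?exprn_even_gt0// ltNge pr.
Qed.

End SignCorrelation.

(** The conditions make [f] nondecreasing on [[0, P]] and give [f (P / n) <= 1 / n]. If [t] lies
    between [k] and [k + 1] steps of length [P / n], then [f t <= (k + 1) / n <= t / P + 1 / n], and
    [n] is arbitrary. *)
Lemma sub_super_additive_le (R : realType) (P : R) (f : R -> R) : 0 < P ->
  (forall x, 0 <= f x) -> f P <= 1 ->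
  (forall x y, f (x + y) <= f x + f y) ->
  (forall x y, 0 <= x -> 0 <= y -> x + y <= P -> f x + f y <= f (x + y)) ->
  forall t, 0 <= t <= P -> f t <= t / P.
Proof.
move=> P0 f0 fP fsub fsuper t /andP[t0 tP].
have f00 : f 0 = 0.
  apply/eqP; rewrite eq_le f0 andbT.
  by have := fsuper 0 0 (lexx _) (lexx _); rewrite addr0 (ltW P0) => /(_ isT); lra.
have fmono x y : 0 <= x -> x <= y -> y <= P -> f x <= f y.
  move=> x0 xy yP; have := fsuper x (y - x) x0; rewrite subr_ge0 xy subrKC yP.
  by move=> /(_ isT isT); have := f0 (y - x); lra.
have fmul k x : f (k%:R * x) <= k%:R * f x.
  elim: k => [|k IHk]; first by rewrite !mul0r f00.
  by rewrite -natr1 !mulrDl !mul1r (le_trans (fsub _ _))// lerD.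
have fmul_ge k x : 0 <= x -> k%:R * x <= P -> k%:R * f x <= f (k%:R * x).
  move=> x0; elim: k => [|k IHk]; first by rewrite !mul0r f00.
  rewrite -natr1 !mulrDl !mul1r => kP.
  have kx0 : 0 <= k%:R * x by rewrite mulr_ge0.
  have := fsuper _ _ kx0 x0 kP; have := IHk; lra.
rewrite leNgt; apply/negP => tf.
have [n nP] : exists n : nat, (f t - t / P)^-1 < n%:R.
  by exists (Num.bound (f t - t / P)^-1); apply: archi_boundP; rewrite invr_ge0; lra.
have d0 : 0 < f t - t / P by lra.
have n0 : (0 : R) < n%:R by rewrite (lt_trans _ nP)// invr_gt0.
have n1 : (1 : R) <= n%:R by rewrite ler1n -(ltr0n R).
pose x := P / n%:R.
have x0 : 0 < x by rewrite divr_gt0.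
have nx : n%:R * x = P by rewrite mulrC divfK ?gt_eqF.
have fx : f x <= n%:R^-1.
  rewrite -[leRHS]mul1r ler_pdivlMr// mulrC.
  have := fmul_ge n x (ltW x0); rewrite nx.
  by move=> /(_ (lexx _)) /le_trans; apply.
pose k := Num.trunc (t / x).
have tx0 : 0 <= t / x by rewrite divr_ge0 // ltW.
have /andP[kt tk] := truncn_itv tx0; rewrite -/k in kt tk.
have kt' : k%:R * x <= t by rewrite -ler_pdivlMr.
have tk' : t < (k%:R + 1) * x by rewrite -ltr_pdivrMr// natr1.
have ft : f t <= k%:R * f x + f x.
  have -> : t = k%:R * x + (t - k%:R * x) by ring.
  apply: (le_trans (fsub _ _)); apply: lerD => //.
  apply: fmono; [lra|lra|].
  by rewrite /x ler_pdivrMr// ler_peMr// ltW.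
have k1 : 0 <= k%:R + 1 :> R by rewrite addr_ge0.
have : f t <= (k%:R + 1) / n%:R.
  by apply: (le_trans ft); rewrite -{2}[f x]mul1r -mulrDl ler_wpM2l.
have -> : (k%:R + 1) / n%:R = k%:R * x / P + n%:R^-1 :> R.
  by rewrite /x; field; rewrite !gt_eqF.
have : k%:R * x / P <= t / P by rewrite ler_pM2r// invr_gt0.
have : n%:R^-1 < f t - t / P by rewrite -[ltRHS]invrK ltf_pV2// posrE invr_gt0.
lra.
Qed.

Section PairLaw.
Variable R : realType.
Local Notation mR := (measurableTypeR R).
Local Notation plane := (mR * mR)%type.

(** By rotation invariance the probability is a function of the angle alone, so the two preceding
    inequalities become sub- and superadditivity. The trivial bound 1 at the angle [pi] fixes the
    scale. *)
Lemma angle_prob_le t : 0 <= t <= pi -> (@angle_prob R 0 t <= (t / pi)%:E)%E.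
Proof.
have [f fE] : exists f : R -> R, forall s, (f s)%:E = @angle_prob R 0 s.
  exists (fun s => fine (@angle_prob R 0 s)) => s.
  rewrite fineK// ge0_fin_numE ?angle_prob_ge0//.
  exact: le_lt_trans (angle_prob_le1 _ _) (ltry _).
move=> t0; rewrite -fE lee_fin; apply: sub_super_additive_le t0.
- exact: pi_gt0.
- by move=> x; rewrite -lee_fin fE angle_prob_ge0.
- by rewrite -lee_fin fE angle_prob_le1.
- move=> x y; rewrite -lee_fin EFinD !fE -[y in leRHS](addrK x) [y + x]addrC.
  rewrite -angle_prob_rot; exact: angle_prob_sub.
- move=> x y x0 y0 xy; rewrite -lee_fin EFinD !fE.
  rewrite (_ : angle_prob 0 y = angle_prob x (x + y)); last first.
    by rewrite (angle_prob_rot x) addrAC subrr add0r.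
  by apply: angle_prob_super; lra.
Qed.

(* The half of Grothendieck's identity that is needed here. *)
Lemma gavgs_disagree (us : seq plane) (p q r : R) : 0 < p -> 0 < q ->
  p ^+ 2 = \sum_(u <- us) u.1 ^+ 2 -> q ^+ 2 = \sum_(u <- us) u.2 ^+ 2 ->
  p * q * r = \sum_(u <- us) u.1 * u.2 ->
  -1 <= r <= 1 /\
  (gavgs us (@disagree R) (0, 0)%R <= (acos r / pi)%:E)%E.
Proof.
move=> p0 q0 ep eq er.
have [a [b [d [a0 d0 [e1 e2 e3] E]]]] :=
  gavgs_reduce us (@measurable_disagree R) (@disagree_ge0 R).
have ap : a = p.
  by apply/eqP; rewrite -(@eqrXn2 _ 2)// ?ltW// ep e1.
move: e2; rewrite ap -er -mulrA => /(mulfI (lt0r_neq0 p0)) bE.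
have rd : d ^+ 2 = q ^+ 2 * (1 - r ^+ 2).
  have -> : q ^+ 2 * (1 - r ^+ 2) = q ^+ 2 - (q * r) ^+ 2 by ring.
  by rewrite eq -e3 bE addrAC subrr add0r.
have r1 : r ^+ 2 <= 1.
  by rewrite -subr_ge0 -(pmulr_rge0 _ (exprn_gt0 2 q0)) -rd sqr_ge0.
have rI : -1 <= r <= 1.
  by rewrite -ler_norml -(@expr_le1 _ 2)// real_normK ?num_real.
split=> //; rewrite E (gavg2_gauss_plane _ _ (@measurable_disagree R)
  (@disagree_ge0 R)) /=.
have dE : d = q * sin (acos r).
  apply/eqP; rewrite -(@eqrXn2 _ 2)//; last first.
    by apply: mulr_ge0; [exact: ltW|rewrite sin_acos// sqrtr_ge0].
  by rewrite rd exprMn sin_acos// sqr_sqrtr// subr_ge0.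
(* The two variables are [p] and [q] times the coordinates along the directions [0] and [acos r];
   positive factors do not affect signs. *)
rewrite (_ : gauss_plane _ = angle_prob 0 (acos r)); last first.
  congr gauss_plane; apply/funext => w.
  rewrite /disagree /dir /= cos0 sin0 acosK// ap bE dE.
  rewrite !mulr0 !mulr1 !addr0.
  have -> : w.1 * p * (w.1 * (q * r) + w.2 * (q * sin (acos r))) =
    (p * q) * (w.1 * (w.1 * r + w.2 * sin (acos r))) by ring.
  by rewrite pmulr_rle0// mulr_gt0.
by apply: angle_prob_le; rewrite acos_ge0// acos_lepi.
Qed.

End PairLaw.

(** * Choosing the Gaussian coefficients *)

Section ConditionalExpectation.
Variable R : realType.
Local Notation mu := (@lebesgue_measure R).
Local Notation mR := (measurableTypeR R).
Local Notation plane := (mR * mR)%type.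
Local Open Scope classical_set_scope.

(** If [h] exceeded [c + e] everywhere, its average would be at least [c + e]. Thanks to the slack
    [e], monotonicity of the integral suffices. *)
Lemma exists_le_gauss_average (h : mR -> \bar R) (c e : R) :
  measurable_fun setT h -> (forall x, 0 <= h x)%E ->
  (\int[mu]_x (h x * (gauss_density x)%:E) <= c%:E)%E -> 0 < e ->
  exists x, (h x <= (c + e)%:E)%E.
Proof.
move=> mh h0 hc e0; apply: contrapT => /forallNP hgt.
have mg : measurable_fun setT (fun x : mR => (gauss_density x)%:E).
  by apply/measurable_EFinP; exact: measurable_gauss_density.
have g0 (x : mR) : (0 <= (gauss_density x)%:E)%E.
  by rewrite lee_fin gauss_density_ge0.
have ce0 : 0 <= c + e.
  apply: addr_ge0; last exact: ltW.
  rewrite -lee_fin; apply: le_trans hc; apply: integral_ge0 => x _.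
  exact: mule_ge0.
have : ((c + e)%:E <= c%:E)%E.
  apply: le_trans hc.
  rewrite -[leLHS]mule1 -(integral_gauss_density R) -ge0_integralZl//.
  apply: ge0_le_integral => //.
  - by move=> x _; rewrite mule_ge0.
  - exact: emeasurable_funM.
  - exact: emeasurable_funM.
  - move=> x _; apply: lee_wpmul2r => //; apply: ltW.
    by rewrite ltNge; apply/negP; exact: hgt.
by rewrite lee_fin; lra.
Qed.

(* Method of conditional expectations: the Gaussian coefficients are fixed one
   at a time, so that no measure on a space of many dimensions is needed. *)
Lemma exists_le_gavgs (K : finType) (J : Type) (u : K -> J -> plane)
    (F : plane -> \bar R) (js : seq J) :
  measurable_fun setT F -> (forall z, 0 <= F z)%E ->
  forall (z : K -> plane) (c e : R), 0 < e ->
  (\sum_k gavgs (map (u k) js) F (z k) <= c%:E)%E ->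
  exists gs : seq (R * J), (\sum_k F
    ((z k).1 + \sum_(p <- gs) p.1 * (u k p.2).1,
     (z k).2 + \sum_(p <- gs) p.1 * (u k p.2).2)%R <= (c + e)%:E)%E.
Proof.
move=> mF F0; elim: js => [|j js IH] z c e e0 /= H.
  exists [::]; apply: le_trans (le_trans H _); last by rewrite lee_fin; lra.
  apply: lee_sum => k _; rewrite !big_nil !addr0.
  by case: (z k).
pose G k := gavgs (map (u k) js) F.
have mG k : measurable_fun setT (G k).
  exact: (proj1 (measurable_gavgs (map (u k) js) mF F0)).
have G0 k w : (0 <= G k w)%E.
  exact: (proj2 (measurable_gavgs (map (u k) js) mF F0)).
pose m k (x : mR) : plane := ((z k).1 + x * (u k j).1, (z k).2 + x * (u k j).2).
have mGm k : measurable_fun setT (fun x : mR => G k (m k x)).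
  apply: (measurableT_comp (mG k)).
  exact: (measurable_fun_pair2 (z k) (measurable_move (u k j))).
have mg : measurable_fun setT (fun x : mR => (gauss_density x)%:E).
  by apply/measurable_EFinP; exact: measurable_gauss_density.
have mh : measurable_fun setT (fun x : mR => \sum_k G k (m k x))%E.
  by apply: emeasurable_sum => k; exact: mGm.
have h0 (x : mR) : (0 <= \sum_k G k (m k x))%E by apply: sume_ge0.
have hc : (\int[mu]_x ((\sum_k G k (m k x)) * (gauss_density x)%:E) <= c%:E)%E.
  apply: le_trans H; rewrite le_eqVlt; apply/orP; left; apply/eqP.
  transitivity (\int[mu]_x \sum_k (G k (m k x) * (gauss_density x)%:E))%E.
    by apply: eq_integral => x _; rewrite ge0_sume_distrl.
  rewrite ge0_integral_sum//.
  + by move=> k; apply: emeasurable_funM.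
  + by move=> k x _; rewrite mule_ge0// lee_fin gauss_density_ge0.
(* Half of the slack pays for the current coefficient, the other half for all later ones. *)
have e2 : 0 < e / 2 by rewrite divr_gt0.
have [x Hx] := exists_le_gauss_average mh h0 hc e2.
have [gs Hgs] := IH (fun k => m k x) (c + e / 2) (e / 2) e2 Hx.
exists ((x, j) :: gs); move: Hgs; rewrite -addrA -splitr; apply: le_trans.
by apply: lee_sum => k _; rewrite !big_cons !addrA.
Qed.

(** By linearity of expectation and [gavgs_disagree], the right side bounds the expected number of
    disagreeing pairs. *)
Lemma exists_few_disagreements (K : finType) (J : Type) (u : K -> J -> plane)
    (js : seq J) (p q r : K -> R) :
  (forall k, 0 < p k) -> (forall k, 0 < q k) ->
  (forall k, p k ^+ 2 = \sum_(j <- js) (u k j).1 ^+ 2) ->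
  (forall k, q k ^+ 2 = \sum_(j <- js) (u k j).2 ^+ 2) ->
  (forall k, p k * q k * r k = \sum_(j <- js) (u k j).1 * (u k j).2) ->
  exists gs : seq (R * J),
    #|[set k | (\sum_(t <- gs) t.1 * (u k t.2).1) *
               (\sum_(t <- gs) t.1 * (u k t.2).2) <= 0]%SET|%:R <=
    \sum_k acos (r k) / pi.
Proof.
move=> p0 q0 ep eq er; set c := \sum_k _.
pose cnt (gs : seq (R * J)) := #|[set k | (\sum_(t <- gs) t.1 * (u k t.2).1) *
               (\sum_(t <- gs) t.1 * (u k t.2).2) <= 0]%SET|.
have H (e : R) : 0 < e -> exists gs : seq (R * J), (cnt gs)%:R <= c + e.
  move=> e0; have [|gs Hgs] := @exists_le_gavgs K J u (@disagree R) js
     (@measurable_disagree R) (@disagree_ge0 R) (fun _ => (0, 0)) c e e0.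
    rewrite -sumEFin; apply: lee_sum => k _.
    apply: (proj2 (gavgs_disagree (p0 k) (q0 k) _ _ _)).
    - by rewrite big_map.
    - by rewrite big_map.
    - by rewrite big_map.
  exists gs; rewrite -lee_fin; apply: le_trans Hgs.
  rewrite /cnt -sum1_card natr_sum -sumEFin big_mkcond /=.
  by apply: lee_sum => k _; rewrite /disagree /= !add0r inE; case: ifP.
have exn : exists n : nat, `[< exists gs, cnt gs = n >].
  by exists (cnt [::]); apply/asboolP; exists [::].
(* Counts are natural numbers, so a minimal one is attained; being at most [c + e] for every
   [e > 0], it is at most [c]. *)
have [gs Hgs] : exists gs, forall gs', (cnt gs <= cnt gs')%N.
  case: (ex_minnP exn) => n /asboolP[gs <-] Hmin.
  by exists gs => gs'; apply: Hmin; apply/asboolP; exists gs'.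
exists gs; rewrite -/(cnt gs) leNgt; apply/negP => lt.
have [|gs' Hgs'] := H (((cnt gs)%:R - c) / 2); first by lra.
by have := Hgs gs'; rewrite -(ler_nat R); lra.
Qed.

End ConditionalExpectation.

(** * The arccosine inequality for triangles *)

Section ArccosInequality.
Variable R : realType.
Implicit Types x y z nu : R.

Lemma le_acos x y : -1 <= x -> x <= y -> y <= 1 -> acos y <= acos x.
Proof.
move=> x1 xy y1.
have xI : -1 <= x <= 1 by rewrite x1 (le_trans xy).
have yI : -1 <= y <= 1 by rewrite y1 (le_trans x1).
rewrite leNgt -ltr_cos ?in_itv /= ?acos_ge0 ?acos_lepi//.
by rewrite !acosK ?in_itv//= -leNgt.
Qed.

Lemma le_acos_cos x t : 0 <= t <= pi -> cos t <= x -> x <= 1 -> acos x <= t.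
Proof.
move=> tI tx x1; rewrite -[leRHS]cosK ?in_itv//=.
by apply: le_acos => //; rewrite cos_geN1.
Qed.

Lemma ge_acos_cos x t : 0 <= t <= pi -> -1 <= x -> x <= cos t -> t <= acos x.
Proof.
move=> tI x1 xt; rewrite -[leLHS]cosK ?in_itv//=.
by apply: le_acos => //; rewrite cos_le1.
Qed.

Lemma cos_addE x y :
  cos x + cos y = 2 * (cos ((x + y) / 2) * cos ((x - y) / 2)).
Proof.
have e u v : cos (u + v) + cos (u - v) = 2 * (cos u * cos v) :> R.
  by rewrite cosB cosD; ring.
by rewrite -e; congr (cos _ + cos _); field.
Qed.

Lemma cos_subE x y :
  cos y - cos x = 2 * (sin ((x + y) / 2) * sin ((x - y) / 2)).
Proof.
have e u v : cos (u - v) - cos (u + v) = 2 * (sin u * sin v) :> R.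
  by rewrite cosB cosD; ring.
by rewrite -e; congr (cos _ - cos _); field.
Qed.

(** Midpoint concavity of [acos (nu * cos x)]. Let [S], [D] be the half-sum and half-difference of
    the two values, and [s], [d] those of [x] and [y]. Sum-to-product formulas give
    [cos S * cos D = nu * (cos s * cos d)] and the same for sines. As [S <= s] and [1 <= nu], the
    sines force [cos D <= cos d], and then the cosines force [nu * cos s <= cos S]. *)
Lemma acos_cos_midpoint nu x y : 1 <= nu ->
  0 <= x <= pi / 2 -> 0 <= y <= pi / 2 -> nu * cos x <= 1 -> nu * cos y <= 1 ->
  nu * cos ((x + y) / 2) <= 1 /\
  acos (nu * cos x) + acos (nu * cos y) <= 2 * acos (nu * cos ((x + y) / 2)).
Proof.
move=> nu1 xI yI nx ny.
have pi0 := pi_gt0 R.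
have cos0 z : 0 <= z <= pi / 2 -> 0 <= cos z.
  by move=> zI; apply: cos_ge0_pihalf; lra.
have cx0 := cos0 _ xI; have cy0 := cos0 _ yI.
have nxI : -1 <= nu * cos x <= 1 by nra.
have nyI : -1 <= nu * cos y <= 1 by nra.
have px : acos (nu * cos x) <= x by apply: le_acos_cos => //; [lra|nra].
have py : acos (nu * cos y) <= y by apply: le_acos_cos => //; [lra|nra].
have p0 := acos_ge0 nxI; have q0 := acos_ge0 nyI.
have cp : cos (acos (nu * cos x)) = nu * cos x by rewrite acosK ?in_itv.
have cq : cos (acos (nu * cos y)) = nu * cos y by rewrite acosK ?in_itv.
move: px py p0 q0 cp cq; set p := acos _; set q := acos _.
move=> px py p0 q0 cp cq.
set S := (p + q) / 2; set D := (p - q) / 2.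
set s := (x + y) / 2; set d := (x - y) / 2.
have e1 : cos S * cos D = nu * (cos s * cos d).
  apply: (@mulfI _ 2) => //; rewrite -cos_addE cp cq -mulrDr cos_addE.
  by rewrite mulrCA.
have e2 : sin S * sin D = nu * (sin s * sin d).
  apply: (@mulfI _ 2) => //; rewrite -cos_subE cp cq -mulrBr cos_subE.
  by rewrite mulrCA.
have sI : 0 <= s <= pi / 2 by rewrite /s; lra.
have SI : 0 <= S <= pi / 2 by rewrite /S; lra.
have Ss : S <= s by rewrite /S /s; lra.
have cd0 : 0 < cos d by apply: cos_gt0_pihalf; rewrite /d; lra.
have cD0 : 0 < cos D by apply: cos_gt0_pihalf; rewrite /D; lra.
have sS0 : 0 <= sin S by apply: sin_ge0_pi; lra.
have cs0 := cos0 _ sI; have cS0 := cos0 _ SI.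
have cScs : cos s <= cos S.
  rewrite leNgt ltr_cos ?in_itv/=; [|lra|lra].
  by rewrite -leNgt.
have sSs : sin S ^+ 2 <= sin s ^+ 2.
  by rewrite !sin2cos2 lerD2l lerN2 lerXn2r ?nnegrE.
have sdD : sin d ^+ 2 <= sin D ^+ 2.
  have [s0|s0] := eqVneq s 0.
    have -> : d = 0 by move: s0; rewrite /s /d; lra.
    by rewrite sin0 expr0n sqr_ge0.
  have ss0 : 0 < sin s by apply: sin_gt0_pi; rewrite lt_neqAle eq_sym s0; lra.
  have e2' : sin S ^+ 2 * sin D ^+ 2 = nu ^+ 2 * (sin s ^+ 2 * sin d ^+ 2).
    by rewrite -!exprMn e2.
  have s20 : 0 < sin s ^+ 2 by rewrite exprn_gt0.
  rewrite -(ler_pM2l s20); apply: le_trans (_ : _ <= sin S ^+ 2 * sin D ^+ 2) _.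
    by rewrite e2' ler_peMl ?exprn_ege1// mulr_ge0// sqr_ge0.
  by rewrite ler_wpM2r// sqr_ge0.
have cDd : cos D <= cos d.
  have : cos D ^+ 2 <= cos d ^+ 2.
    by rewrite !cos2sin2 lerD2l lerN2.
  by rewrite ler_pXn2r// nnegrE ltW.
have nS : nu * cos s <= cos S.
  rewrite -(ler_pM2r cD0) e1 mulrA ler_wpM2l// mulr_ge0//; lra.
have ns0 : 0 <= nu * cos s by rewrite mulr_ge0//; lra.
split; first by rewrite (le_trans nS)// cos_le1.
have : S <= acos (nu * cos s) by apply: ge_acos_cos => //; lra.
by rewrite /S; lra.
Qed.

(* [a], [b], [c] are the cosines of the angles of a triangle, [a] being that of
   the largest one.  The midpoint inequality replaces the two smaller angles by
   their mean, and the isosceles case is a perfect square. *)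
Lemma acos_triangle nu a b c : 1 <= nu <= 2 -> 0 <= b -> 0 <= c ->
  nu * b <= 1 -> nu * c <= 1 -> -1 <= nu * a -> a <= b -> a <= c ->
  0 <= a + b * c -> (a + b * c) ^+ 2 = (1 - b ^+ 2) * (1 - c ^+ 2) ->
  acos (nu * a) + acos (nu * b) + acos (nu * c) <= 3 * acos (nu / 2).
Proof.
move=> /andP[nu1 nu2] b0 c0 nb nc na ab ac abc0 abc.
have pi0 := pi_gt0 R.
have b1 : b <= 1 by nra.
have c1 : c <= 1 by nra.
have bI : -1 <= b <= 1 by lra.
have cI : -1 <= c <= 1 by lra.
have acos_pihalf x : 0 <= x <= 1 -> 0 <= acos x <= pi / 2.
  move=> xI; rewrite acos_ge0 /=; last by lra.
  by rewrite -(acos0 R); apply: le_acos; lra.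
have BI := acos_pihalf b _; have CI := acos_pihalf c _.
have {}BI : 0 <= acos b <= pi / 2 by apply: BI; lra.
have {}CI : 0 <= acos c <= pi / 2 by apply: CI; lra.
have := acos_cos_midpoint nu1 BI CI.
rewrite !acosK ?in_itv//= => /(_ nb nc).
set s := (_ + _) / 2; set y := cos s => -[ny mid].
(* The hypothesis [abc] says that the angles with cosines [a], [b], [c] add up to [pi]. Hence
   [a = 1 - 2 * y ^+ 2], where [y] is the cosine of the mean of the two smaller angles. *)
have cosBC : cos (acos b + acos c) = - a.
  rewrite cosD !acosK ?in_itv//= !sin_acos//.
  rewrite -sqrtrM ?subr_ge0 ?expr_le1// -abc sqrtr_sqr ger0_norm//; ring.
have aE : a = 1 - 2 * y ^+ 2.
  have : cos (s + s) = - a by rewrite -cosBC; congr cos; rewrite /s; field.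
  rewrite cosD -!expr2 sin2cos2 -/y; lra.
have y0 : 0 <= y by apply: cos_ge0_pihalf; rewrite /s; lra.
have bcy : b + c <= 2 * y.
  have := cosD s ((acos b - acos c) / 2).
  have := cosB s ((acos b - acos c) / 2).
  have -> : s + (acos b - acos c) / 2 = acos b by rewrite /s; field.
  have -> : s - (acos b - acos c) / 2 = acos c by rewrite /s; field.
  rewrite !acosK ?in_itv//= -/y.
  have := cos_le1 ((acos b - acos c) / 2); set e := cos _ => e1; nra.
(* Since [a] is at most the mean of [b] and [c], it is at most [y]; so [1 - 2 * y ^+ 2 <= y]. *)
have y12 : 1 / 2 <= y by nra.
have nyI : -1 <= nu * y <= 1 by nra.
have nu2I : -1 <= nu / 2 <= 1 by lra.
have m0 := acos_ge0 nyI; have al0 := acos_ge0 nu2I.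
have cm : cos (acos (nu * y)) = nu * y by rewrite acosK ?in_itv.
have cal : cos (acos (nu / 2)) = nu / 2 by rewrite acosK ?in_itv.
have mal : acos (nu * y) <= acos (nu / 2) by apply: le_acos; nra.
have naI : -1 <= nu * a <= 1 by nra.
suff : acos (nu * a) <= 3 * acos (nu / 2) - 2 * acos (nu * y) by lra.
have sm := cos2Dsin2 (acos (nu * y)); have sal := cos2Dsin2 (acos (nu / 2)).
move: m0 al0 cm cal mal sm sal; set m := acos (nu * y); set al := acos (nu / 2).
move=> m0 al0 cm cal mal sm sal.
have [Tpi|Tpi] := leP pi (3 * al - 2 * m).
  by apply: le_trans Tpi; apply: acos_lepi.
apply: le_acos_cos; [lra| |lra].
have -> : 3 * al - 2 * m = al + al + al - (m + m) by ring.
rewrite cosB !(cosD, sinD) cm cal aE.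
move: sm sal; rewrite cm cal; set w := sin m; set t := sin al => sm sal.
rewrite -subr_ge0.
have -> : nu * (1 - 2 * y ^+ 2) = nu - 2 * nu * y ^+ 2 by ring.
set rhs := (X in 0 <= X).
(* The squared factor is [sin (m - al)], which vanishes in the equilateral case. *)
have -> : rhs = (nu ^+ 2 - 1) * (2 / nu) * (nu / 2 * w - nu * y * t) ^+ 2.
  have t2 : t ^+ 2 = 1 - (nu / 2) ^+ 2 by lra.
  have w2 : w ^+ 2 = 1 - (nu * y) ^+ 2 by lra.
  transitivity (nu - 2 * nu * y ^+ 2
      - ((nu / 2) ^+ 3 - 3 * (nu / 2) * t ^+ 2) * ((nu * y) ^+ 2 - w ^+ 2)
      - 2 * w * (nu * y) * t * (3 * (nu / 2) ^+ 2 - t ^+ 2)).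
    by rewrite /rhs; ring.
  transitivity ((nu ^+ 2 - 1) * (2 / nu) * ((nu / 2) ^+ 2 * w ^+ 2
      - nu * w * (nu * y) * t + (nu * y) ^+ 2 * t ^+ 2)); last by field; lra.
  by rewrite t2 w2; field; lra.
by rewrite mulr_ge0 ?sqr_ge0// mulr_ge0//; [nra|rewrite divr_ge0//; lra].
Qed.

End ArccosInequality.

Section GramInequality.
Variable R : realType.
Implicit Types x y z r nu : R.

(** After division by [nu] the equations are the projection formulas of a triangle with sides [r1],
    [r2], [r3] and angle cosines [a], [b], [c]. Only the smallest cosine can be negative, as two
    negative terms cannot add up to a side. Eliminating [r3] and multiplying the two results gives
    the relation required by [acos_triangle]. *)
Lemma acos_gram_min nu r1 r2 r3 x y z : 1 <= nu <= 2 ->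
  0 < r1 -> 0 < r2 -> 0 < r3 -> -1 <= x -> y <= 1 -> z <= 1 ->
  x * r2 + y * r3 = nu * r1 -> x * r1 + z * r3 = nu * r2 ->
  y * r1 + z * r2 = nu * r3 -> x <= y -> x <= z ->
  acos x + acos y + acos z <= 3 * acos (nu / 2).
Proof.
move=> /andP[nu1 nu2] r10 r20 r30 x1 y1 z1 e1 e2 e3 xy xz.
have nu0 : 0 < nu by lra.
have [a aE] : exists a, x = nu * a.
  by exists (x / nu); rewrite mulrC divfK ?gt_eqF.
have [b bE] : exists b, y = nu * b.
  by exists (y / nu); rewrite mulrC divfK ?gt_eqF.
have [c cE] : exists c, z = nu * c.
  by exists (z / nu); rewrite mulrC divfK ?gt_eqF.
subst x y z; rewrite !ler_pM2l// in xy xz.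
have {}e1 : a * r2 + b * r3 = r1 by apply: (mulfI (lt0r_neq0 nu0)); lra.
have {}e2 : a * r1 + c * r3 = r2 by apply: (mulfI (lt0r_neq0 nu0)); lra.
have {}e3 : b * r1 + c * r2 = r3 by apply: (mulfI (lt0r_neq0 nu0)); lra.
have b0 : 0 <= b.
  rewrite leNgt; apply/negP => b0.
  have : a * r2 < 0 by rewrite pmulr_llt0//; lra.
  have : b * r3 < 0 by rewrite pmulr_llt0.
  lra.
have c0 : 0 <= c.
  rewrite leNgt; apply/negP => c0.
  have : a * r1 < 0 by rewrite pmulr_llt0//; lra.
  have : c * r3 < 0 by rewrite pmulr_llt0.
  lra.
have b1 : b <= 1 by apply: le_trans y1; rewrite ler_peMl.
have h1 : r1 * (1 - b ^+ 2) = r2 * (a + b * c).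
  have e : r1 = a * r2 + b * (b * r1 + c * r2) by rewrite e3 e1.
  by rewrite mulrBr mulr1 {1}e; ring.
have h2 : r2 * (1 - c ^+ 2) = r1 * (a + b * c).
  have e : r2 = a * r1 + c * (b * r1 + c * r2) by rewrite e3 e2.
  by rewrite mulrBr mulr1 {1}e; ring.
have abc0 : 0 <= a + b * c.
  by rewrite -(pmulr_rge0 _ r20) -h1 mulr_ge0 ?(ltW r10)// subr_ge0 expr_le1.
apply: acos_triangle => //; first by rewrite nu1.
apply: (@mulfI _ (r1 * r2)); first by rewrite mulf_neq0// gt_eqF.
by rewrite [RHS]mulrACA h1 h2; ring.
Qed.

Lemma acos_gram nu r1 r2 r3 x y z : 1 <= nu <= 2 ->
  0 < r1 -> 0 < r2 -> 0 < r3 ->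
  -1 <= x <= 1 -> -1 <= y <= 1 -> -1 <= z <= 1 ->
  x * r2 + y * r3 = nu * r1 -> x * r1 + z * r3 = nu * r2 ->
  y * r1 + z * r2 = nu * r3 ->
  acos x + acos y + acos z <= 3 * acos (nu / 2).
Proof.
move=> nuI r10 r20 r30 /andP[x0 x1] /andP[y0 y1] /andP[z0 z1] e1 e2 e3.
have [xy|yx] := leP x y.
  have [xz|zx] := leP x z; first exact: (@acos_gram_min nu r1 r2 r3).
  have -> : acos x + acos y + acos z = acos z + acos y + acos x by ring.
  by apply: (@acos_gram_min nu r3 r2 r1) => //; lra.
have [yz|zy] := leP y z.
  have -> : acos x + acos y + acos z = acos y + acos x + acos z by ring.
  by apply: (@acos_gram_min nu r1 r3 r2) => //; lra.
have -> : acos x + acos y + acos z = acos z + acos y + acos x by ring.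
by apply: (@acos_gram_min nu r3 r2 r1) => //; lra.
Qed.

End GramInequality.

(** * Quadratic forms and the least eigenvalue *)

Section QuadraticForm.
Variables (R : realType) (T : finType).
Implicit Types (B : T -> T -> R) (f g : T -> R).

Definition qform B f : R := \sum_i \sum_j f i * B i j * f j.

Lemma psd_kernel B f : (forall i j, B i j = B j i) ->
  (forall g, 0 <= qform B g) -> qform B f = 0 ->
  forall j, \sum_i f i * B i j = 0.
Proof.
move=> symB B0 Bf; pose h j := \sum_i f i * B i j.
have Bfh : \sum_i \sum_j f i * B i j * h j = \sum_j h j ^+ 2.
  rewrite exchange_big /=; apply: eq_bigr => j _.
  by rewrite -mulr_suml expr2.
have Bhf : \sum_i \sum_j h i * B i j * f j = \sum_j h j ^+ 2.
  apply: eq_bigr => j _; rewrite expr2 {3}/h mulr_sumr.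
  by apply: eq_bigr => i _; rewrite (symB j i); ring.
set c := \sum_j h j ^+ 2 in Bfh Bhf.
have expand t : qform B (fun i => t * f i + h i) = 2 * t * c + qform B h.
  transitivity (t ^+ 2 * qform B f + t * (\sum_i \sum_j f i * B i j * h j) +
     t * (\sum_i \sum_j h i * B i j * f j) + qform B h); last first.
    by rewrite Bf Bfh Bhf; ring.
  rewrite !mulr_sumr -!big_split /=; apply: eq_bigr => i _.
  rewrite !mulr_sumr -!big_split /=; apply: eq_bigr => j _; ring.
have c0 : 0 <= c by apply: sumr_ge0 => j _; exact: sqr_ge0.
have cE : c = 0.
  apply/eqP; rewrite eq_le c0 andbT leNgt; apply/negP => cpos.
  (* This value of [t] would make the form equal to -1. *)
  have := B0 (fun i => - (qform B h + 1) / (2 * c) * f i + h i).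
  rewrite expand (_ : 2 * _ * c = - (qform B h + 1)); first by lra.
  by field; rewrite gt_eqF.
move=> j; apply/eqP; rewrite -sqrf_eq0.
move/eqP: cE; rewrite psumr_eq0 => [|i _]; last exact: sqr_ge0.
by move=> /allP/(_ j (mem_index_enum _)).
Qed.

End QuadraticForm.

Section MinEigenvalue.
Variables (R : realType) (n : nat).
Local Open Scope classical_set_scope.

Lemma continuous_qform (A : 'I_n -> 'I_n -> R) :
  continuous (fun y : 'rV[R]_n => qform A (fun i => y ord0 i)).
Proof.
have addc : continuous (fun z : R * R => z.1 + z.2).
  by move=> z; exact: add_continuous.
rewrite /qform; apply: (continuous_big addc) => i _.
apply: (continuous_big addc) => j _ y.
have c k : {for y, continuous (fun x : 'rV[R]_n => x ord0 k)}.
  exact: coord_continuous.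
exact: (cvgM (cvgM (c i) (cvg_cst (A i j))) (c j)).
Qed.

(** The Rayleigh quotient: the form attains its minimum [m] on the compact unit sphere, and a
    minimizer is a null vector of the positive semidefinite form of [A - m I], hence an eigenvector
    by [psd_kernel]. *)
Lemma min_eigenvalue (A : 'M[R]_n) : (0 < n)%N -> A^T = A ->
  exists2 m, eigenvalue A m &
    forall f : 'I_n -> R, m * (\sum_i f i ^+ 2) <= qform A f.
Proof.
move=> n0 symA; pose I (i j : 'I_n) : R := (i == j)%:R.
have qI f : qform I f = \sum_i f i ^+ 2.
  apply: eq_bigr => i _; rewrite (bigD1 i) //= big1 ?addr0 => [|j ji].
    by rewrite /I eqxx mulr1.
  by rewrite /I eq_sym (negbTE ji) mulr0 mul0r.
pose S := [set y : 'rV[R]_n | qform I (fun i => y ord0 i) = 1].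
have cS : compact S.
  apply: bounded_closed_compact.
    exists 1; split; first exact: num_real.
    move=> M M1 y; rewrite /S /= qI => yS.
    rewrite /Num.norm /= mx_normrE; apply/bigmax_leP; split; first by lra.
    move=> [i j] _ /=; rewrite (ord1 i); apply: le_trans (ltW M1).
    rewrite -(@expr_le1 _ 2)// real_normK ?num_real// -yS.
    by rewrite (bigD1 j)//= lerDl sumr_ge0// => k _; exact: sqr_ge0.
  apply: (@closed_comp _ _ (fun y : 'rV[R]_n => qform I (fun i => y ord0 i))
    [set 1]); last exact: closed_eq.
  by move=> y _; exact: continuous_qform.
have S0 : S !=set0.
  exists (\row_j (j == Ordinal n0)%:R); rewrite /S /= qI.
  rewrite (bigD1 (Ordinal n0))//= big1 ?addr0 => [|i iN].
    by rewrite mxE eqxx expr1n.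
  by rewrite mxE (negbTE iN) expr0n.
have [x xS xmin] := EVT_min_rV S0 cS
  (continuous_subspaceT (@continuous_qform (fun i j => A i j))).
rewrite inE in xS; set m := qform _ _ in xmin.
have qZ (B : 'I_n -> 'I_n -> R) t f :
    qform B (fun i => t * f i) = t ^+ 2 * qform B f.
  rewrite /qform !mulr_sumr; apply: eq_bigr => i _.
  by rewrite !mulr_sumr; apply: eq_bigr => j _; ring.
have mle f : m * qform I f <= qform (fun i j => A i j) f.
  have [f0|f0] := eqVneq (qform I f) 0.
    have fz i : f i = 0.
      apply/eqP; rewrite -sqrf_eq0; move/eqP: f0; rewrite qI.
      rewrite psumr_eq0 => [|k _]; last exact: sqr_ge0.
      by move=> /allP/(_ i (mem_index_enum _)).
    rewrite f0 mulr0 /qform big1// => i _; rewrite big1// => j _.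
    by rewrite fz !mul0r.
  have fpos : 0 < qform I f.
    by rewrite lt_neqAle eq_sym f0 qI sumr_ge0// => i _; exact: sqr_ge0.
  have s2 : Num.sqrt (qform I f) ^+ 2 = qform I f by rewrite sqr_sqrtr// ltW.
  pose y : 'rV[R]_n := \row_i ((Num.sqrt (qform I f))^-1 * f i).
  have yE B : qform B (fun i => y ord0 i) = (qform I f)^-1 * qform B f.
    rewrite -s2 -exprVn -qZ; congr (qform _ _).
    by apply/funext => i; rewrite mxE.
  have := xmin y; rewrite inE /S /= !yE mulVf// => /(_ erefl).
  by rewrite mulrC ler_pdivlMr.
exists m; last by move=> f; rewrite -qI; exact: mle.
pose B i j := A i j - m * I i j.
have qB f : qform B f = qform (fun i j => A i j) f - m * qform I f.
  rewrite /qform mulr_sumr -sumrB; apply: eq_bigr => i _.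
  by rewrite mulr_sumr -sumrB; apply: eq_bigr => j _; rewrite /B; ring.
have Bsym i j : B i j = B j i by rewrite /B /I eq_sym -{1}symA mxE.
have B0 f : 0 <= qform B f by rewrite qB subr_ge0.
have Bx : qform B (fun i => x ord0 i) = 0.
  by rewrite qB xS mulr1 subrr.
apply/eigenvalueP; exists x.
  apply/rowP => j; have := psd_kernel Bsym B0 Bx j.
  rewrite !mxE /B; under eq_bigr do rewrite mulrBr.
  rewrite sumrB => /eqP; rewrite subr_eq0 => /eqP ->.
  rewrite (bigD1 j)//= big1 ?addr0 => [|i ij]; first by rewrite /I eqxx mulr1 mulrC.
  by rewrite /I (negbTE ij) !mulr0.
apply/eqP => x0; move: xS; rewrite /S /= qI x0.
rewrite big1 => [/esym/eqP|i _]; first by rewrite oner_eq0.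
by rewrite mxE expr0n.
Qed.

End MinEigenvalue.

(** * Eigenfunctions of cubic graphs *)

Section CubicGraph.
Variables (R : realType) (G : sgraph).
Hypothesis G_regular : regular 3 G.
Implicit Types (u v x y : G) (w f : G -> R) (lam : R).

Definition nbr v (i : nat) : G := nth v (enum [set y : G | adj v y]) i.

Lemma enum_nbr v :
  enum [set y : G | adj v y] = [:: nbr v 0; nbr v 1; nbr v 2].
Proof.
by move: (G_regular v); rewrite cardE /nbr;
  case: (enum _) => [|a [|b [|c [|d s]]]].
Qed.

Lemma sum_nbr (F : G -> R) v :
  \sum_(u | adj v u) F u = F (nbr v 0) + F (nbr v 1) + F (nbr v 2).
Proof.
transitivity (\sum_(u <- enum [set y : G | adj v y]) F u).
  by rewrite big_enum; apply: eq_bigl => u; rewrite inE.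
by rewrite enum_nbr !big_cons big_nil addr0 addrA.
Qed.

Lemma mem_nbr v u :
  adj v u = [|| u == nbr v 0, u == nbr v 1 | u == nbr v 2].
Proof.
have : (u \in enum [set y : G | adj v y]) = adj v u by rewrite mem_enum inE.
by rewrite enum_nbr !inE => <-.
Qed.

Lemma adj_nbr v i : (i < 3)%N -> adj v (nbr v i).
Proof. by case: i => [|[|[|]]] // _; rewrite mem_nbr eqxx ?orbT. Qed.

Lemma nbr01 v : nbr v 0 != nbr v 1.
Proof.
have := enum_uniq [set y : G | adj v y].
by rewrite enum_nbr /= !inE negb_or -andbA => /andP[].
Qed.

(** The zero function is allowed; nonvanishing is stated separately. *)
Definition eigenfunction lam w := forall v, \sum_(u | adj v u) w u = lam * w v.

Lemma sum_adj f v : \sum_u f u * (adj u v)%:R = \sum_(u | adj v u) f u.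
Proof.
rewrite [RHS]big_mkcond; apply: eq_bigr => u _; rewrite adj_sym.
by case: ifP => _; rewrite ?mulr1 ?mulr0.
Qed.

Lemma eigenvalue_eigenfunction lam : eigenvalue (adjacency_matrix R G) lam ->
  exists2 w, eigenfunction lam w & exists v, w v != 0.
Proof.
move=> /eigenvalueP[y yA y0]; exists (fun v => y ord0 (enum_rank v)); last first.
  have [i yi] : exists i, y ord0 i != 0.
    apply/existsP; rewrite -negb_forall; apply: contra y0 => /forallP y0.
    by apply/eqP/rowP => i; rewrite mxE; apply/eqP; rewrite y0.
  by exists (enum_val i); rewrite enum_valK.
move=> v; have := congr1 (fun M : 'rV_#|G| => M ord0 (enum_rank v)) yA.
rewrite !mxE => <-; rewrite -sum_adj (reindex _ (onW_bij _ (enum_val_bij G))).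
by apply: eq_bigr => i _; rewrite mxE enum_rankK enum_valK.
Qed.

Definition shifted_adj lam u v : R := (adj u v)%:R - lam * (u == v)%:R.

Lemma shifted_adj_sym lam u v : shifted_adj lam u v = shifted_adj lam v u.
Proof. by rewrite /shifted_adj adj_sym eq_sym. Qed.

Lemma shifted_adj_kernel lam f :
  (forall v, \sum_u f u * shifted_adj lam u v = 0) -> eigenfunction lam f.
Proof.
move=> f0 v; have := f0 v.
under eq_bigr do rewrite /shifted_adj mulrBr.
rewrite sumrB sum_adj => /eqP; rewrite subr_eq0 => /eqP ->.
rewrite (bigD1 v)//= big1 ?addr0 => [|u uv]; first by rewrite eqxx mulr1 mulrC.
by rewrite (negbTE uv) !mulr0.
Qed.

(** The eigenvalue [m] of [min_eigenvalue] bounds the form from below, and [lam <= m] by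
    minimality. *)
Lemma shifted_adj_psd lam : least_eigenvalue (adjacency_matrix R G) lam ->
  forall f, 0 <= qform (shifted_adj lam) f.
Proof.
move=> [elam lmin] f.
have G0 : (0 < #|G|)%N.
  have [w _ [v _]] := eigenvalue_eigenfunction elam.
  by apply/card_gt0P; exists v.
have symA : (adjacency_matrix R G)^T = adjacency_matrix R G.
  by apply/matrixP => i j; rewrite !mxE adj_sym.
have [m /lmin lm mq] := min_eigenvalue G0 symA.
have bij := onW_bij predT (enum_val_bij G).
have := mq (fun i => f (enum_val i)).
have -> : \sum_(i < #|G|) f (enum_val i) ^+ 2 = \sum_u f u ^+ 2.
  by rewrite [RHS](reindex _ bij).
have -> : qform (fun i j => adjacency_matrix R G i j) (fun i => f (enum_val i)) =
    \sum_u \sum_v f u * (adj u v)%:R * f v.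
  rewrite [RHS](reindex _ bij); apply: eq_bigr => i _.
  by rewrite [RHS](reindex _ bij); apply: eq_bigr => j _; rewrite mxE.
have -> : qform (shifted_adj lam) f =
    \sum_u \sum_v f u * (adj u v)%:R * f v - lam * \sum_u f u ^+ 2.
  rewrite mulr_sumr -sumrB; apply: eq_bigr => u _.
  have -> : lam * f u ^+ 2 = \sum_v f u * (lam * (u == v)%:R) * f v.
    rewrite (bigD1 u)//= big1 ?addr0 => [|v uv]; first by rewrite eqxx mulr1; ring.
    by rewrite eq_sym (negbTE uv) !(mulr0, mul0r).
  by rewrite -sumrB; apply: eq_bigr => v _; rewrite /shifted_adj; ring.
rewrite subr_ge0; apply: le_trans; rewrite ler_wpM2r//.
by apply: sumr_ge0 => u _; exact: sqr_ge0.
Qed.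

Definition edge_fun x y u : R := (u == x)%:R - (u == y)%:R.

Lemma sum_edge_fun x y (h : G -> R) : \sum_u edge_fun x y u * h u = h x - h y.
Proof.
have sum_pt z : \sum_u (u == z)%:R * h u = h z.
  rewrite (bigD1 z)//= big1 ?addr0 => [|u uz]; first by rewrite eqxx mul1r.
  by rewrite (negbTE uz) mul0r.
under eq_bigr do rewrite mulrBl.
by rewrite sumrB !sum_pt.
Qed.

Lemma qform_edge_fun lam x y : adj x y ->
  qform (shifted_adj lam) (edge_fun x y) = - 2 * (1 + lam).
Proof.
move=> xy.
have -> : qform (shifted_adj lam) (edge_fun x y) =
    \sum_u edge_fun x y u * \sum_v edge_fun x y v * shifted_adj lam u v.
  apply: eq_bigr => u _; rewrite mulr_sumr.
  by apply: eq_bigr => v _; ring.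
rewrite !sum_edge_fun /shifted_adj !eqxx !adj_irr xy adj_sym xy.
have /negbTE xy0 : x != y by apply: contraTneq xy => ->; rewrite adj_irr.
by rewrite xy0 [y == x]eq_sym xy0 /= ?mulr1n ?mulr0n; ring.
Qed.

Section LeastEigenvalue.
Variable lam : R.
Hypothesis lamP : least_eigenvalue (adjacency_matrix R G) lam.

(** The form of the adjacency matrix minus [lam] is nonnegative, and on [edge_fun] of an edge it
    equals [- 2 * (1 + lam)]. *)
Lemma least_eigenvalue_leN1 : lam <= -1.
Proof.
have [w _ [v _]] := eigenvalue_eigenfunction lamP.1.
have := shifted_adj_psd lamP (edge_fun v (nbr v 0)).
by rewrite qform_edge_fun ?adj_nbr//; lra.
Qed.

(* For [lam = -1] the difference of the indicators of two adjacent vertices is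
   an eigenfunction, and choosing it ensures that the variance of [X v - X u]
   does not vanish on edges. *)
Lemma least_eigenfunction : exists w, [/\ eigenfunction lam w,
  exists v, w v != 0 &
  lam = -1 -> exists a b, w a != 0 /\ forall x, w x != 0 -> x = a \/ x = b].
Proof.
have [w ew [v wv]] := eigenvalue_eigenfunction lamP.1.
have [lamE|lamN] := eqVneq lam (-1); last first.
  by exists w; split=> //; [exists v|move=> e; rewrite e eqxx in lamN].
have vn : adj v (nbr v 0) by exact: adj_nbr.
have vnN : v != nbr v 0 by apply: contraTneq vn => <-; rewrite adj_irr.
have ev : edge_fun v (nbr v 0) v != 0.
  by rewrite /edge_fun eqxx (negbTE vnN) subr0 oner_neq0.
exists (edge_fun v (nbr v 0)); split.
- apply: shifted_adj_kernel; apply: psd_kernel.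
  + exact: shifted_adj_sym.
  + exact: shifted_adj_psd.
  + by rewrite qform_edge_fun// lamE; ring.
- by exists v.
- move=> _; exists v, (nbr v 0); split=> // x; rewrite /edge_fun.
  have [->|xv] := eqVneq x v; first by left.
  by have [->|xn] := eqVneq x (nbr v 0); [right|rewrite subrr eqxx].
Qed.

End LeastEigenvalue.

End CubicGraph.

(** Two agreeing pairs among three numbers share a member, so all three would have its strict
    sign. *)
Lemma three_signs (R : realType) (a b c : R) :
  ~~ [&& 0 < a, 0 < b & 0 < c] -> ~~ [&& a < 0, b < 0 & c < 0] ->
  (2 <= (a * b <= 0)%R + (a * c <= 0)%R + (b * c <= 0)%R)%N.
Proof.
have same (x y z : R) : 0 < x * y -> 0 < x * z ->
    [&& 0 < x, 0 < y & 0 < z] || [&& x < 0, y < 0 & z < 0].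
  case: (ltrgt0P x) => [x0|x0|->]; rewrite ?mul0r ?ltxx//.
    by rewrite !pmulr_rgt0// => -> ->.
  by rewrite !nmulr_rgt0// => -> ->.
move=> Npos Nneg.
have [ab|ab] := leP (a * b) 0; have [ac|ac] := leP (a * c) 0;
  have [bc|bc] := leP (b * c) 0 => //; exfalso.
- have := same c a b; rewrite mulrC ac mulrC bc => /(_ isT isT).
  rewrite [(0 < c) && _]andbC [(c < 0) && _]andbC -!andbA.
  by rewrite (negbTE Npos) (negbTE Nneg).
- have := same b a c; rewrite mulrC ab bc => /(_ isT isT).
  by rewrite andbCA [(b < 0) && _]andbCA (negbTE Npos) (negbTE Nneg).
- by have := same a b c ab ac; rewrite (negbTE Npos) (negbTE Nneg).
- by have := same a b c ab ac; rewrite (negbTE Npos) (negbTE Nneg).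
Qed.

Definition locmax (R : realType) (G : sgraph) (X : G -> R) : {set G} :=
  [set v | [forall u, adj v u ==> (X u < X v)]].

Definition locmin (R : realType) (G : sgraph) (X : G -> R) : {set G} :=
  [set v | [forall u, adj v u ==> (X v < X u)]].

(** * Covariances of the random eigenfunction and its local extrema *)

Section Covariance.
Variables (R : realType) (G : sgraph).
Hypothesis G_regular : regular 3 G.
Hypothesis G_transitive : vertex_transitive G.
Variables (lam : R) (w : G -> R).
Hypothesis w_eigen : eigenfunction lam w.
Hypothesis w_neq0 : exists v, w v != 0.
Hypothesis w_edge :
  lam = -1 -> exists a b, w a != 0 /\ forall x, w x != 0 -> x = a \/ x = b.
Hypothesis lam_leN1 : lam <= -1.
Implicit Types (u v x y : G) (s t : {perm G}).

Definition aut (s : {perm G}) : bool := `[< automorphism s >].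

Lemma autP s : reflect (automorphism s) (aut s).
Proof. exact: asboolP. Qed.

Definition auts : seq {perm G} := [seq s <- enum {perm G} | aut s].

Lemma sum_auts (F : {perm G} -> R) : \sum_(s <- auts) F s = \sum_(s | aut s) F s.
Proof. by rewrite /auts big_filter big_enum_cond. Qed.

(* The covariance of the Gaussian eigenfunction [\sum_s g_s * (w \o s)], with
   independent standard Gaussian coefficients indexed by the automorphisms. *)
Definition cov x y : R := \sum_(s <- auts) w (s x) * w (s y).

Lemma covC x y : cov x y = cov y x.
Proof. by apply: eq_bigr => s _; rewrite mulrC. Qed.

(** Multiplication by [t] permutes the automorphisms. *)
Lemma cov_aut t x y : automorphism t -> cov (t x) (t y) = cov x y.
Proof.
move=> tA; rewrite /cov !sum_auts [RHS](reindex_inj (mulgI t)) /=.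
apply: eq_big => [s|s _]; last by rewrite !permM.
apply/autP/autP => sA.
  by move=> a b; rewrite !permM sA tA.
move=> a b; rewrite -(permKV t a) -(permKV t b).
by have := sA (t^-1%g a) (t^-1%g b); rewrite !permM tA.
Qed.

Lemma cov_diag x y : cov x x = cov y y.
Proof. by have [t tA <-] := G_transitive x y; rewrite cov_aut. Qed.

Lemma cov_gt0 x : 0 < cov x x.
Proof.
have [v wv] := w_neq0; rewrite (cov_diag x v) /cov sum_auts.
have aut1 : aut 1%g by apply/autP => a b; rewrite !perm1.
rewrite (bigD1 1%g)//= ltr_pwDl//.
  by rewrite perm1 -expr2 lt_neqAle sqr_ge0 eq_sym sqrf_eq0 wv.
by apply: sumr_ge0 => s _; rewrite -expr2 sqr_ge0.
Qed.

Lemma sum_adj_aut s v : aut s -> \sum_(u | adj v u) w (s u) = lam * w (s v).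
Proof.
move=> /autP sA; rewrite -w_eigen [RHS](reindex_inj (@perm_inj _ s)) /=.
by apply: eq_bigl => u; rewrite sA.
Qed.

Lemma cov_eigen v y : \sum_(u | adj v u) cov u y = lam * cov v y.
Proof.
rewrite /cov exchange_big mulr_sumr /= !sum_auts; apply: eq_bigr => s sA.
by rewrite -mulr_suml sum_adj_aut// mulrA.
Qed.

Lemma sum_sqrD x y : \sum_(s <- auts) (w (s x) + w (s y)) ^+ 2 =
  2 * (cov x x + cov x y).
Proof.
rewrite mulrDr {1}mulr2n mulrDl mul1r {2}(cov_diag x y) /cov mulr_sumr.
rewrite -!big_split /=; apply: eq_bigr => s _; ring.
Qed.

Lemma sum_sqrB x y : \sum_(s <- auts) (w (s x) - w (s y)) ^+ 2 =
  2 * (cov x x - cov x y).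
Proof.
rewrite mulrBr {1}mulr2n mulrDl mul1r {2}(cov_diag x y) /cov mulr_sumr.
rewrite -big_split -sumrB /=; apply: eq_bigr => s _; ring.
Qed.

Lemma cov_geN x y : 0 <= cov x x + cov x y.
Proof.
have : 0 <= \sum_(s <- auts) (w (s x) + w (s y)) ^+ 2.
  by apply: sumr_ge0 => s _; exact: sqr_ge0.
by rewrite sum_sqrD pmulr_rge0.
Qed.

Lemma sum_auts_eq0 (F : {perm G} -> R) s : \sum_(s <- auts) F s ^+ 2 = 0 ->
  aut s -> F s = 0.
Proof.
move=> /eqP; rewrite psumr_eq0 => [|? _]; last exact: sqr_ge0.
move=> /allP F0 sA; apply/eqP; rewrite -sqrf_eq0.
by apply: F0; rewrite mem_filter sA mem_enum.
Qed.

Lemma sum_nbr_covD v :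
  \sum_(u | adj v u) (cov v v + cov v u) = (3 + lam) * cov v v.
Proof.
rewrite big_split /=; under [X in _ + X]eq_bigr do rewrite covC.
by rewrite cov_eigen (sum_nbr G_regular (fun _ => cov v v)); ring.
Qed.

(** Each [cov v v + cov v u] is half the variance of [X v + X u], and by the eigenvalue equation
    these add up over the neighbours to [3 + lam] times a variance. *)
Lemma lam_geN3 : -3 <= lam.
Proof.
have [v _] := w_neq0; have k0 := cov_gt0 v.
have : 0 <= \sum_(u | adj v u) (cov v v + cov v u).
  by apply: sumr_ge0 => u _; exact: cov_geN.
by rewrite sum_nbr_covD pmulr_lge0//; lra.
Qed.

(* If [w \o s] agrees at the ends of the edge [v u] for all [s], then
   [lam = -1] and [w \o s] takes opposite values at [v] and at its other
   neighbours, so no automorphic image of [w] vanishes near [v]. *)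
Lemma cov_edge_lt v u : adj v u -> cov v u < cov v v.
Proof.
move=> vu; rewrite ltNge; apply/negP => vule; have k0 := cov_gt0 v.
have sB : \sum_(s <- auts) (w (s v) - w (s u)) ^+ 2 = 0.
  apply/eqP; rewrite eq_le sumr_ge0 ?andbT => [|s _]; last exact: sqr_ge0.
  by rewrite sum_sqrB; lra.
have uE : cov v u = cov v v by move: sB; rewrite sum_sqrB; lra.
have rest0 y : 0 <= cov v v + cov v y by exact: cov_geN.
(* The neighbour [u] takes [2 * cov v v] of the sum, leaving [(1 + lam) * cov v v] to the others.
   This is nonnegative, which forces [lam = -1], and then every other term is zero. *)
have := sum_nbr_covD v; rewrite (bigD1 u)//= uE => restE.
have restE' : \sum_(y | adj v y && (y != u)) (cov v v + cov v y) =
    (1 + lam) * cov v v by lra.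
have rest_ge0 : 0 <= \sum_(y | adj v y && (y != u)) (cov v v + cov v y).
  by apply: sumr_ge0.
have lamE : lam = -1.
  have lam1 := lam_leN1.
  by move: rest_ge0; rewrite restE' pmulr_lge0//; lra.
have opp y : adj v y -> y != u -> cov v v + cov v y = 0.
  move=> vy yu; move/eqP: restE'; rewrite lamE subrr mul0r psumr_eq0//.
  by move=> /allP/(_ y (mem_index_enum _)); rewrite vy yu => /eqP.
have [a [b [wa wab]]] := w_edge lamE.
(* [s] sends each neighbour of [v] to a vertex adjacent to [a] where [w] does not vanish, that is,
   to [b]; this contradicts injectivity. *)
have [s sA sv] := G_transitive v a.
have sA' : aut s by apply/autP.
have wy y : adj v y -> w (s y) != 0.
  move=> vy; have [->|yu] := eqVneq y u.
    have := sum_auts_eq0 sB sA'; rewrite sv => /eqP; rewrite subr_eq0 => /eqP <-.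
    exact: wa.
  have sD : \sum_(s <- auts) (w (s v) + w (s y)) ^+ 2 = 0.
    by rewrite sum_sqrD opp// mulr0.
  have := sum_auts_eq0 sD sA'; rewrite sv => /eqP; rewrite addr_eq0 => /eqP wE.
  by move: wa; rewrite wE oppr_eq0.
have sb y : adj v y -> s y = b.
  move=> vy; have [sya|//] := wab _ (wy _ vy).
  by move: vy; rewrite -sA sv sya adj_irr.
have /negP[] := nbr01 G_regular v.
by apply/eqP/(@perm_inj _ s); rewrite !sb// adj_nbr.
Qed.

Definition diff v (i : nat) s : R := w (s v) - w (s (nbr v i)).

Definition gram v i j : R := \sum_(s <- auts) diff v i s * diff v j s.

Lemma gramC v i j : gram v i j = gram v j i.
Proof. by apply: eq_bigr => s _; rewrite mulrC. Qed.

Lemma gram_diag v i : gram v i i = 2 * (cov v v - cov v (nbr v i)).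
Proof. by rewrite -sum_sqrB; apply: eq_bigr => s _; rewrite -expr2. Qed.

Lemma gram_gt0 v i : (i < 3)%N -> 0 < gram v i i.
Proof.
move=> i3; rewrite gram_diag pmulr_rgt0// subr_gt0.
by apply: cov_edge_lt; exact: adj_nbr.
Qed.

(** By the eigenvalue equation the three differences [X v - X u_i] add up to [(3 - lam) * X v]. As
    all vertices have the same variance, the covariance of a difference with [X v] is half the
    variance of that difference. *)
Lemma gram_row v i :
  gram v i 0 + gram v i 1 + gram v i 2 = (3 - lam) / 2 * gram v i i.
Proof.
have -> : gram v i 0 + gram v i 1 + gram v i 2 =
    \sum_(s <- auts) (3 - lam) * (diff v i s * w (s v)).
  rewrite -!big_split /= !sum_auts; apply: eq_bigr => s sA.
  have := sum_adj_aut v sA; rewrite (sum_nbr G_regular (fun u => w (s u))) => e.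
  by rewrite -!mulrDr mulrCA; congr (_ * _); rewrite /diff; lra.
rewrite -mulr_sumr gram_diag.
have -> : \sum_(s <- auts) diff v i s * w (s v) = cov v v - cov v (nbr v i).
  by rewrite [cov v (nbr v i)]covC /cov -sumrB; apply: eq_bigr => s _; rewrite mulrBl.
by field.
Qed.

Definition gnorm v i : R := Num.sqrt (gram v i i).

Lemma gnorm_gt0 v i : (i < 3)%N -> 0 < gnorm v i.
Proof. by move=> i3; rewrite sqrtr_gt0 gram_gt0. Qed.

Lemma gnorm_sqr v i : (i < 3)%N -> gnorm v i ^+ 2 = gram v i i.
Proof. by move=> i3; rewrite sqr_sqrtr// ltW// gram_gt0. Qed.

Definition corr v i j : R := gram v i j / (gnorm v i * gnorm v j).

Lemma corrE v i j : (i < 3)%N -> (j < 3)%N ->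
  gnorm v i * gnorm v j * corr v i j = gram v i j.
Proof.
by move=> i3 j3; rewrite mulrC divfK// mulf_neq0// gt_eqF// gnorm_gt0.
Qed.

Definition diff_pair v i j s : measurableTypeR R * measurableTypeR R :=
  (diff v i s, diff v j s).

(** This is the Cauchy-Schwarz inequality, already contained in [gavgs_disagree]. *)
Lemma corr_bound v i j : (i < 3)%N -> (j < 3)%N -> -1 <= corr v i j <= 1.
Proof.
move=> i3 j3.
apply: (proj1 (@gavgs_disagree R (map (diff_pair v i j) auts) _ _ _
  (gnorm_gt0 v i3) (gnorm_gt0 v j3) _ _ _)).
- by rewrite big_map gnorm_sqr//; apply: eq_bigr => s _; rewrite -expr2.
- by rewrite big_map gnorm_sqr//; apply: eq_bigr => s _; rewrite -expr2.
- by rewrite big_map corrE.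
Qed.

(** Dividing [gram_row] by [gnorm v i] and moving the diagonal term to the right gives the equations
    of [acos_gram] with [nu = (3 - lam) / 2 - 1]. The bounds on [lam] say that [1 <= nu <= 2]. *)
Lemma corr_acos v :
  acos (corr v 0 1) + acos (corr v 0 2) + acos (corr v 1 2) <=
  3 * acos ((1 - lam) / 4).
Proof.
have -> : (1 - lam) / 4 = (1 - lam) / 2 / 2 by field.
have lam3 := lam_geN3; have lam1 := lam_leN1.
have [n0 n1 n2] : [/\ gnorm v 0 != 0, gnorm v 1 != 0 & gnorm v 2 != 0].
  by split; rewrite gt_eqF// gnorm_gt0.
apply: (@acos_gram R _ (gnorm v 0) (gnorm v 1) (gnorm v 2));
  rewrite ?gnorm_gt0 ?corr_bound//.
- lra.
- apply: (mulfI n0); have := gram_row v 0.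
  rewrite -(corrE v (i := 0) (j := 1))// -(corrE v (i := 0) (j := 2))//.
  by rewrite -gnorm_sqr// => e; lra.
- apply: (mulfI n1); have := gram_row v 1; rewrite [gram v 1 0]gramC.
  rewrite -(corrE v (i := 0) (j := 1))// -(corrE v (i := 1) (j := 2))//.
  by rewrite -gnorm_sqr// => e; lra.
- apply: (mulfI n2); have := gram_row v 2; rewrite [gram v 2 0]gramC [gram v 2 1]gramC.
  rewrite -(corrE v (i := 0) (j := 2))// -(corrE v (i := 1) (j := 2))//.
  by rewrite -gnorm_sqr// => e; lra.
Qed.

(* ['I_3] indexes the pairs (0, 1), (0, 2), (1, 2) of neighbours. *)
Definition first_idx (i : 'I_3) : nat := if i == 2 :> nat then 1 else 0.
Definition second_idx (i : 'I_3) : nat := if i == 0 :> nat then 1 else 2.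

(** Double counting of [B], the disagreeing pairs of differences at all vertices: coefficients are
    chosen that make [B] small, while each vertex that is not an extremum contributes at least two
    pairs. *)
Lemma exists_many_extrema : exists X : G -> R,
  (1 - 3 / (2 * pi) * acos ((1 - lam) / 4)) * #|G|%:R <=
  #|locmax X :|: locmin X|%:R.
Proof.
have f3 i : (first_idx i < 3)%N by rewrite /first_idx; case: ifP.
have s3 i : (second_idx i < 3)%N by rewrite /second_idx; case: ifP.
have [|||||gs] := @exists_few_disagreements R (G * 'I_3)%type {perm G}
  (fun k => diff_pair k.1 (first_idx k.2) (second_idx k.2)) auts
  (fun k => gnorm k.1 (first_idx k.2)) (fun k => gnorm k.1 (second_idx k.2))
  (fun k => corr k.1 (first_idx k.2) (second_idx k.2)).
- by move=> k; rewrite gnorm_gt0.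
- by move=> k; rewrite gnorm_gt0.
- by move=> k; rewrite gnorm_sqr//; apply: eq_bigr => s _; rewrite -expr2.
- by move=> k; rewrite gnorm_sqr//; apply: eq_bigr => s _; rewrite -expr2.
- by move=> k; rewrite corrE.
set B := [set k | _]; move=> Ble.
pose X v := \sum_(t <- gs) t.1 * w (t.2 v).
pose d v i := X v - X (nbr v i).
have dE v i : \sum_(t <- gs) t.1 * diff v i t.2 = d v i.
  by rewrite /d /X -sumrB; apply: eq_bigr => t _; rewrite /diff mulrBr.
have inB v i : ((v, i) \in B) = (d v (first_idx i) * d v (second_idx i) <= 0).
  by rewrite inE /= !dE.
exists X; set U := _ :|: _.
have pi0 := pi_gt0 R.
have Bub : #|B|%:R <= #|G|%:R * (3 * acos ((1 - lam) / 4) / pi) :> R.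
  apply: le_trans Ble _; rewrite mulr_natl -sumr_const -(pair_bigA _ (fun v i =>
    acos (corr v (first_idx i) (second_idx i)) / pi)) /=.
  apply: ler_sum => v _; rewrite !big_ord_recl big_ord0 addr0 /=.
  rewrite -!mulrDl ler_pM2r ?invr_gt0// addrA.
  exact: corr_acos.
have Blb : (2 * #|~: U| <= #|B|)%N.
  have -> : #|B| = (\sum_v \sum_(i < 3) ((v, i) \in B))%N.
    rewrite pair_bigA -sum1_card big_mkcond /=.
    by apply: eq_bigr => -[v i] _ /=; case: ifP.
  rewrite mulnC -sum_nat_const [X in (_ <= X)%N](bigID (fun v => v \in ~: U)) /=.
  apply: leq_trans (leq_addr _ _); apply: leq_sum => v.
  rewrite !inE negb_or => /andP[Nmax Nmin].
  rewrite !big_ord_recl big_ord0 addn0 addnA !inB /=.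
  have := @three_signs R (d v 0) (d v 1) (d v 2).
  have -> : [&& 0 < d v 0, 0 < d v 1 & 0 < d v 2] = false.
    apply: contraNF Nmax => /and3P[d0 d1 d2]; apply/forallP => u.
    rewrite (mem_nbr G_regular); apply/implyP => /or3P[]/eqP->;
    by rewrite -subr_gt0.
  have -> : [&& d v 0 < 0, d v 1 < 0 & d v 2 < 0] = false.
    apply: contraNF Nmin => /and3P[d0 d1 d2]; apply/forallP => u.
    rewrite (mem_nbr G_regular); apply/implyP => /or3P[]/eqP->;
    by rewrite -subr_lt0.
  by move=> /(_ isT isT).
have UE : #|U|%:R + #|~: U|%:R = #|G|%:R :> R by rewrite -natrD cardsC.
have : 2 * #|~: U|%:R <= #|B|%:R :> R by rewrite -natrM ler_nat.
have -> : (1 - 3 / (2 * pi) * acos ((1 - lam) / 4)) * #|G|%:R =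
    #|G|%:R - #|G|%:R * (3 * acos ((1 - lam) / 4) / pi) / 2.
  have : (pi : R) != 0 by rewrite gt_eqF.
  by move: (pi : R) => p p0; field.
by lra.
Qed.

End Covariance.

(** * From local extrema to independent sets *)

Section Extrema.
Variables (R : realType) (G : sgraph).
Implicit Types (X : G -> R) (I : {set G}).

Lemma independent_locmax X : independent (locmax X).
Proof.
apply/forallP => x; apply/implyP; rewrite inE => /forallP xm.
apply/forallP => y; apply/implyP; rewrite inE => /forallP ym.
apply/negP => xy; have := implyP (xm y) xy.
by rewrite ltNge (ltW (implyP (ym x) _))// adj_sym.
Qed.

Lemma independent_locmin X : independent (locmin X).
Proof.
apply/forallP => x; apply/implyP; rewrite inE => /forallP xm.
apply/forallP => y; apply/implyP; rewrite inE => /forallP ym.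
apply/negP => xy; have := implyP (xm y) xy.
by rewrite ltNge (ltW (implyP (ym x) _))// adj_sym.
Qed.

(** Regularity supplies a neighbour; an isolated vertex would lie in both sets. *)
Lemma disjoint_locmax_locmin X : regular 3 G -> [disjoint locmax X & locmin X].
Proof.
move=> G_regular; apply/pred0P => v /=; apply/negbTE/negP => /andP[].
rewrite !inE => /forallP/(_ (nbr v 0)) + /forallP/(_ (nbr v 0)).
by rewrite adj_nbr//= => lt1 lt2; have := lt_trans lt1 lt2; rewrite ltxx.
Qed.

Lemma bipartite_independentU I1 I2 : independent I1 -> independent I2 ->
  bipartite (induced_subgraph (I1 :|: I2)).
Proof.
move=> /forallP ind1 /forallP ind2; exists (fun x => val x \in I1) => x y /= xy.
have := valP x; have := valP y; rewrite !inE.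
have := implyP (ind1 (val x)); have := implyP (ind2 (val x)).
have [x1 _ /(_ isT)/forallP/(_ (val y))|_ + _ + /= x2] := boolP (val x \in I1).
  by rewrite xy implybF => /negbTE->.
move=> /(_ x2)/forallP/(_ (val y)); rewrite xy implybF => /negbTE->.
by rewrite orbF => ->.
Qed.

Lemma independence_number_ge I : independent I ->
  (#|I| <= independence_number G)%N.
Proof. by move=> Iind; rewrite /independence_number; apply: leq_bigmax_cond. Qed.

End Extrema.

Lemma asin_acos (R : realType) (x : R) : -1 <= x <= 1 ->
  asin x = pi / 2 - acos x.
Proof.
move=> xI; rewrite -[in LHS](acosK _ : cos (acos x) = x) ?in_itv//.
rewrite -cosN -sinDpihalf addrC sinK// in_itv/=.
have := acos_ge0 xI; have := acos_lepi xI; lra.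
Qed.

Theorem theorem3 (R : realType) (G : sgraph) (lambda_min : R)
    (G_regular : regular 3 G) (G_transitive : vertex_transitive G)
    (lambda_minP : least_eigenvalue (adjacency_matrix R G) lambda_min) :
  [/\ q3 lambda_min = 2^-1 - 3 / (4 * pi) * acos ((1 - lambda_min) / 4),
      q3 lambda_min <= independence_ratio R G
    & exists I1 I2 : {set G},
        [/\ independent I1, independent I2, [disjoint I1 & I2],
            2 * q3 lambda_min * #|G|%:R <= #|I1 :|: I2|%:R
          & bipartite (induced_subgraph (I1 :|: I2)) /\
            2 * q3 lambda_min * #|G|%:R <= #|induced_subgraph (I1 :|: I2)|%:R]].
Proof.
have pin : (pi : R) != 0 by rewrite gt_eqF// pi_gt0.
have [w [we wn wedge]] := least_eigenfunction G_regular lambda_minP.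
have lam1 := least_eigenvalue_leN1 G_regular lambda_minP.
have lam3 := lam_geN3 G_regular G_transitive we wn.
have q3E : q3 lambda_min = 2^-1 - 3 / (4 * pi) * acos ((1 - lambda_min) / 4).
  rewrite /q3 asin_acos; last lra.
  by move: (pi : R) pin => p pn; field.
have [X] := exists_many_extrema G_regular G_transitive we wn wedge lam1.
have -> : 1 - 3 / (2 * pi) * acos ((1 - lambda_min) / 4) = 2 * q3 lambda_min.
  by rewrite q3E; move: (pi : R) pin => p pn; field.
have ind1 := independent_locmax X; have ind2 := independent_locmin X.
have dis := disjoint_locmax_locmin X G_regular.
move: ind1 ind2 dis; set I1 := locmax X; set I2 := locmin X => ind1 ind2 dis UX.
split=> //; last first.
  exists I1, I2; split=> //; split; first exact: bipartite_independentU.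
  by rewrite card_sig.
have G0 : 0 < #|G|%:R :> R.
  by have [v _] := wn; rewrite ltr0n; apply/card_gt0P; exists v.
(* The larger of the two sets has at least half of the vertices of the union. *)
rewrite /independence_ratio ler_pdivlMr//.
have := independence_number_ge ind1; have := independence_number_ge ind2.
rewrite -!(ler_nat R) => i2 i1.
have : #|I1 :|: I2|%:R <= #|I1|%:R + #|I2|%:R :> R.
  by rewrite -natrD ler_nat leq_card_setU.
lra.
Qed.
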